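(* Let $n>2$, let $1<p<\frac{2^n-1}{2^n-3}$, and let $X_1=\frac{\partial}{\partial x_1}$ and $X_2=x_1\frac{\partial}{\partial x_2}+x_1^2\frac{\partial}{\partial x_3}+\dots+x_1^{n-1}\frac{\partial}{\partial x_n}$ on $\mathbb{R}^n$, with $X=(X_1,X_2)$. Let $u_0\in L^1_{\mathrm{loc}}(\mathbb{R}^n)$. If $f\in L^1_{\mathrm{loc}}(\mathbb{R}^n)$ with $\int_{\mathbb{R}^n}f(x)\,dx>0$, then the problem $u_t-\Delta_X u=|u|^p+f(x)$ in $(0,\infty)\times\mathbb{R}^n$, $u(0,x)=u_0(x)$, does not admit a global in time weak solution.
   Context: For a system $X=(X_1,\dots,X_m)$ of real $C^\infty$ vector fields, $\Delta_X=-\sum_{k=1}^m X_k^\ast X_k$ with $X_k^\ast=-X_k-\operatorname{div}X_k$; here the vector fields are divergence free, so $\Delta_X=X_1^2+X_2^2$. Weak solution: for $f,u_0\in L^1_{\mathrm{loc}}(\mathbb{R}^n)$, a function $u\in L^p_{\mathrm{loc}}((0,T),L^p_{\mathrm{loc}}(\mathbb{R}^n))$ is a local in time weak solution (on $[0,T)$) of $u_t-\Delta_X u=|u|^p+f(x)$, $u(0,x)=u_0(x)$, if for every non-negative test function $\psi\in C^1_c([0,T);C^2_c(\mathbb{R}^n))$ one has $\int_0^T\!\int_{\mathbb{R}^n}|u|^p\psi+\int_{\mathbb{R}^n}u_0\psi(0,x)+\int_0^T\!\int_{\mathbb{R}^n}f\psi+\int_0^T\!\int_{\mathbb{R}^n}u\psi_t+\int_0^T\!\int_{\mathbb{R}^n}u\,\Delta_X\psi=0$.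 When $T=\infty$, such $u$ is called a global in time weak solution. *)

(* Defs.v *)
From HB Require Import structures.
From mathcomp Require Import all_boot all_order all_algebra.
From mathcomp Require Import all_classical all_reals all_analysis.

Set Implicit Arguments.
Unset Strict Implicit.
Unset Printing Implicit Defensive.

Import Order.TTheory GRing.Theory Num.Theory.
Import numFieldNormedType.Exports.

Local Open Scope classical_set_scope.
Local Open Scope ring_scope.

Definition rV_display : measure_display -> measure_display.
Proof. exact. Qed.

(* The sigma-algebra on R^n generated by the coordinates; for T = R with its
   Borel sets this is the Borel sigma-algebra of R^n. *)
Section measurable_rV.
Context {d} {T : measurableType d} (n : nat).

Let coord (i : 'I_n) (x : 'rV[T]_n) : T := x ord0 i.

Let rV_set0 : g_sigma_preimage coord set0.
Proof. exact: sigma_algebra0. Qed.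

Let rV_setC A : g_sigma_preimage coord A -> g_sigma_preimage coord (~` A).
Proof. exact: sigma_algebraC. Qed.

Let rV_bigcup (F : _^nat) : (forall i, g_sigma_preimage coord (F i)) ->
  g_sigma_preimage coord (\bigcup_i (F i)).
Proof. exact: sigma_algebra_bigcup. Qed.

HB.instance Definition _ := @isMeasurable.Build (rV_display d)
  'rV[T]_n (g_sigma_preimage coord) rV_set0 rV_setC rV_bigcup.

Lemma measurable_rV_coord (i : 'I_n) :
  measurable_fun [set: 'rV[T]_n] (fun x => x ord0 i).
Proof.
move=> _ Y mY; rewrite setTI; apply: sub_sigma_algebra.
rewrite -bigcup_seq/=; exists i => /=; first by rewrite mem_index_enum.
by exists Y => //; rewrite setTI.
Qed.

Lemma measurable_fun_rV d' (T' : measurableType d') (f : T' -> 'rV[T]_n) :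
  (forall i, measurable_fun [set: T'] (fun z => f z ord0 i)) ->
  measurable_fun [set: T'] f.
Proof.
move=> mf; apply: measurability => // B [C].
rewrite -bigcup_seq/= => -[i _ [Y mY <-]] <-; rewrite !setTI.
by have := mf i measurableT Y mY; rewrite setTI.
Qed.

End measurable_rV.

Section lebesgue_rV.
Context {R : realType}.
Implicit Types n : nat.

Definition rV_cons n (z : measurableTypeR R * 'rV[R]_n) : 'rV[R]_n.+1 :=
  \row_i if unlift ord0 i is Some j then z.2 ord0 j else z.1.

Definition rV_uncons n (x : 'rV[R]_n.+1) : measurableTypeR R * 'rV[R]_n :=
  (x ord0 ord0, \row_j x ord0 (lift ord0 j)).

Lemma rV_consK n : cancel (@rV_cons n) (@rV_uncons n).
Proof.
move=> [t x]; rewrite /rV_uncons mxE unlift_none; congr (_, _).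
by apply/rowP => j; rewrite !mxE liftK.
Qed.

Lemma measurable_rV_cons n : measurable_fun setT (@rV_cons n).
Proof.
apply: measurable_fun_rV => i.
under eq_fun do rewrite mxE.
case: (unlift ord0 i) => [j|]; last exact: measurable_fst.
exact: (measurableT_comp (measurable_rV_coord j) measurable_snd).
Qed.

Lemma measurable_rV_uncons n : measurable_fun setT (@rV_uncons n).
Proof.
apply: measurable_fun_pair; first exact: measurable_rV_coord.
apply: measurable_fun_rV => i.
under eq_fun do rewrite mxE.
exact: measurable_rV_coord.
Qed.

Section step.
Variables (n : nat) (m : {sigma_finite_measure set 'rV[R]_n -> \bar R}).

Definition lebesgue_rVS : set 'rV[R]_n.+1 -> \bar R :=
  pushforward (lebesgue_measure \x m)%E (@rV_cons n).

Let lebesgue_rVS0 : lebesgue_rVS set0 = 0%E.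
Proof. by rewrite /lebesgue_rVS /pushforward preimage_set0 measure0. Qed.

Let lebesgue_rVS_ge0 A : (0 <= lebesgue_rVS A)%E.
Proof. exact: (measure_ge0 (lebesgue_measure \x m)%E). Qed.

Let lebesgue_rVS_sigma_additive : semi_sigma_additive lebesgue_rVS.
Proof.
pose mu := measure_function_pushforward__canonical__measure_function_Measure
  (lebesgue_measure \x m)%E (@measurable_rV_cons n).
exact: (@measure_semi_sigma_additive _ _ _ mu).
Qed.

HB.instance Definition _ := isMeasure.Build _ _ _ lebesgue_rVS
  lebesgue_rVS0 lebesgue_rVS_ge0 lebesgue_rVS_sigma_additive.

Let sigma_finite_lebesgue_rVS : sigma_finite setT lebesgue_rVS.
Proof.
pose l : {sigma_finite_measure set (measurableTypeR R) -> \bar R} :=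
  lebesgue_measure.
have /sigma_finiteP[F [FT ndF Foo]] := sigma_finiteT l.
have /sigma_finiteP[G [GT ndG Goo]] := sigma_finiteT m.
exists (fun i => @rV_uncons n @^-1` (F i `*` G i)).
  apply/seteqP; split=> // x _.
  have [i _ Fi] : (\bigcup_i F i) (rV_uncons x).1 by rewrite -FT.
  have [j _ Gj] : (\bigcup_i G i) (rV_uncons x).2 by rewrite -GT.
  exists (maxn i j) => //; split.
  - by move: Fi; exact/subsetPset/ndF/leq_maxl.
  - by move: Gj; exact/subsetPset/ndG/leq_maxr.
move=> i; have [mF Fi] := Foo i; have [mG Gi] := Goo i; split.
  rewrite -[X in measurable X]setTI; apply: measurable_rV_uncons => //.
  exact: measurableX.
rewrite /lebesgue_rVS /pushforward -comp_preimage.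
rewrite (_ : _ \o _ = id); last exact/funext/rV_consK.
rewrite preimage_id product_measure1E//.
by rewrite lte_mul_pinfty// ge0_fin_numE.
Qed.

HB.instance Definition _ :=
  Measure_isSigmaFinite.Build _ _ _ lebesgue_rVS sigma_finite_lebesgue_rVS.

End step.

(* Lebesgue measure on R^n: the n-fold product of lebesgue_measure. *)
Fixpoint lebesgue_rV n : {sigma_finite_measure set 'rV[R]_n -> \bar R} :=
  if n is n'.+1 then lebesgue_rVS (lebesgue_rV n')
  else \d_ (0 : 'rV[R]_0).

Lemma lebesgue_rV_box n (A : 'I_n -> set R) :
  (forall i, measurable (A i)) ->
  lebesgue_rV n [set x | forall i, A i (x ord0 i)] =
  (\prod_(i < n) lebesgue_measure (A i))%E.
Proof.
elim: n A => [|n IH] A mA.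
  by rewrite big_ord0 /= diracE mem_set// => -[].
rewrite big_ord_recl /= /lebesgue_rVS /pushforward.
rewrite (_ : _ @^-1` _ = A ord0 `*`
    [set x : 'rV[R]_n | forall i, A (lift ord0 i) (x ord0 i)]).
  rewrite product_measure1E //; last first.
    rewrite (_ : [set _ | _] = \bigcap_(i in [set: 'I_n])
      ((fun x : 'rV[R]_n => x ord0 i) @^-1` A (lift ord0 i))).
      apply: fin_bigcap_measurable => // i _.
      by rewrite -[X in measurable X]setTI; exact: measurable_rV_coord.
    by apply/seteqP; split=> x /= Ax => [i _|i]; exact: Ax.
  - exact: mA.
  - by congr (_ * _)%E; exact: (IH (fun i => A (lift ord0 i))).
apply/seteqP; split=> [[t x]|[t x]] /=.
  move=> Ax; split; first by have := Ax ord0; rewrite mxE unlift_none.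
  by move=> i; have := Ax (lift ord0 i); rewrite mxE liftK.
by move=> [At Ax] i; rewrite mxE; case: unliftP => [j ->|->] //; exact: Ax.
Qed.

End lebesgue_rV.

Section vector_fields.
Context {R : realType} {n : nat}.
Implicit Types (g : 'rV[R]_n -> R) (V : 'rV[R]_n -> 'rV[R]_n).

Definition partial (i : 'I_n) g : 'rV[R]_n -> R :=
  fun x => 'D_(delta_mx ord0 i) g x.

(* A vector field is given by its coefficients: V = \sum_i V_i d/dx_i. *)
Definition vf_apply V g : 'rV[R]_n -> R :=
  fun x => \sum_(i < n) V x ord0 i * partial i g x.

Definition divergence V : 'rV[R]_n -> R :=
  fun x => \sum_(i < n) partial i (fun y => V y ord0 i) x.

Definition vf_adjoint V g : 'rV[R]_n -> R :=
  fun x => - vf_apply V g x - divergence V x * g x.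

Definition vf_laplacian m (X : 'I_m -> 'rV[R]_n -> 'rV[R]_n) g : 'rV[R]_n -> R :=
  fun x => - \sum_(k < m) vf_adjoint (X k) (vf_apply (X k) g) x.

End vector_fields.

Section test_functions.
Context {R : realType} {n : nat}.
Implicit Types (g : 'rV[R]_n -> R) (T : \bar R) (psi dpsi : R -> 'rV[R]_n -> R).

Fixpoint Ck (k : nat) g : Prop :=
  continuous g /\
  if k is k'.+1 then
    forall i, (forall x, derivable g x (delta_mx ord0 i)) /\ Ck k' (partial i g)
  else True.

(* The C^k norm of g, i.e. the largest sup norm of a partial derivative of
   order at most k, does not exceed e. *)
Fixpoint Ck_norm_le (k : nat) g (e : R) : Prop :=
  (forall x, `|g x| <= e) /\
  if k is k'.+1 then forall i, Ck_norm_le k' (partial i g) e else True.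

Definition Ck_supported (k : nat) (K : set 'rV[R]_n) g : Prop :=
  Ck k g /\ closure [set x | g x != 0] `<=` K.

Definition time_interval T : set R := [set t | 0 <= t /\ (t%:E < T)%E].

(* psi belongs to C^1_c([0,T); C^2_c(R^n)) and dpsi is its time derivative.
   Since C^2_c(R^n) is the strict inductive limit of the Banach spaces C^2_K of
   C^2 functions supported in the compact set K, and psi has compact support in
   time, this means that psi is a C^1 map into a single C^2_K, the limits being
   taken in the C^2 norm.  The derivative at t = 0 is one-sided; values of psi
   outside [0,T) are irrelevant. *)
Definition test_function T psi dpsi : Prop :=
  [/\ exists2 K : set 'rV[R]_n, compact K &
        forall t, time_interval T t ->
          Ck_supported 2 K (psi t) /\ Ck_supported 2 K (dpsi t),
      exists2 S : R, (S%:E < T)%E &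
        forall t, time_interval T t -> S < t -> forall x, psi t x = 0,
      forall t, time_interval T t -> forall e, 0 < e ->
        \forall s \near within (time_interval T) t^',
          Ck_norm_le 2 (fun x => (psi s x - psi t x) / (s - t) - dpsi t x) e &
      forall t, time_interval T t -> forall e, 0 < e ->
        \forall s \near within (time_interval T) (nbhs t),
          Ck_norm_le 2 (fun x => dpsi s x - dpsi t x) e].

End test_functions.

Section weak_solutions.
Context {R : realType} {n : nat}.
Implicit Types (f : 'rV[R]_n -> R) (u : R -> 'rV[R]_n -> R) (T : \bar R).

Definition L1loc f : Prop :=
  measurable_fun setT f /\
  forall K, compact K ->
    (\int[lebesgue_rV n]_(x in K) `|f x|%:E < +oo)%E.

Definition open_time_interval T : set R := [set t | 0 < t /\ (t%:E < T)%E].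

Definition Lploc_spacetime (p : R) T u : Prop :=
  measurable_fun (open_time_interval T `*` [set: 'rV[R]_n])
    (fun z => u z.1 z.2) /\
  forall (a b : R) K, 0 < a -> (b%:E < T)%E -> compact K ->
    (\int[lebesgue_measure]_(t in `[a, b])
       \int[lebesgue_rV n]_(x in K) (`|u t x| `^ p)%:E < +oo)%E.

(* u_t - Delta_X u = |u|^p + f in (0,T) x R^n, u(0,x) = u0(x).
   Integrals are extended-real valued, and in \bar R one has +oo - oo = -oo,
   so the identity below forces the integrals to exist and to be finite. *)
Definition weak_solution m (X : 'I_m -> 'rV[R]_n -> 'rV[R]_n) (p : R)
    f (u0 : 'rV[R]_n -> R) T u : Prop :=
  Lploc_spacetime p T u /\
  forall psi dpsi : R -> 'rV[R]_n -> R, test_function T psi dpsi ->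
    (forall t x, time_interval T t -> 0 <= psi t x) ->
    (\int[lebesgue_measure]_(t in open_time_interval T)
       \int[lebesgue_rV n]_x (`|u t x| `^ p * psi t x)%:E
     + \int[lebesgue_rV n]_x (u0 x * psi 0%R x)%:E
     + \int[lebesgue_measure]_(t in open_time_interval T)
         \int[lebesgue_rV n]_x (f x * psi t x)%:E
     + \int[lebesgue_measure]_(t in open_time_interval T)
         \int[lebesgue_rV n]_x (u t x * dpsi t x)%:E
     + \int[lebesgue_measure]_(t in open_time_interval T)
         \int[lebesgue_rV n]_x (u t x * vf_laplacian X (psi t) x)%:E = 0)%E.

Definition global_weak_solution m (X : 'I_m -> 'rV[R]_n -> 'rV[R]_n) (p : R)
    f (u0 : 'rV[R]_n -> R) u : Prop :=
  weak_solution X p f u0 +oo%E u.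

End weak_solutions.

(* With x_1, ..., x_(n+1) stored at the indices 0, ..., n, the coefficient of
   d/dx_(i+1) in X_2 is x_1^i for i >= 1. *)
Section fields.
Context {R : realType} {n : nat}.

Definition field1 (x : 'rV[R]_n.+1) : 'rV[R]_n.+1 := delta_mx ord0 ord0.

Definition field2 (x : 'rV[R]_n.+1) : 'rV[R]_n.+1 :=
  \row_i if i == ord0 then 0 else x ord0 ord0 ^+ i.

Definition fields (k : 'I_2) : 'rV[R]_n.+1 -> 'rV[R]_n.+1 :=
  if k == ord0 then field1 else field2.

End fields.

(* Main.v *)
(* Test the equation against psi = a(t) b(x), where b is a power of
   (1 - \sum_i (x_i / r^i)^2)_+ and a is the same kind of bump around the time
   2 r^2.  Since a(0) = 0 the initial datum drops out, so u0 needs no decay.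
   Both fields are homogeneous of degree one for the dilations
   (x_i) |-> (r^i x_i), whence |psi_t| + |Delta_X psi| <= C r^-2 psi^(1/p) once
   the power is large.  Young's inequality absorbs the terms linear in u into
   \int\int |u|^p psi and leaves, with q the conjugate exponent of p,
   r^2 \int f b <= C r^(-2 q) r^(2 + n (n + 1) / 2).  As
   n (n + 1) / 2 <= 2^n - 1 < 2 q, the right-hand side is o(r^2), while
   \int f b stays above a positive constant, a contradiction. *)
Require Import Defs.
From mathcomp Require Import all_boot all_order all_algebra.
From mathcomp Require Import all_classical all_reals all_analysis.
From mathcomp Require Import measurable_realfun ring lra zify.

Import Order.TTheory GRing.Theory Num.Theory.
Import numFieldNormedType.Exports.

Local Open Scope classical_set_scope.
Local Open Scope ring_scope.

Set Implicit Arguments.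
Unset Strict Implicit.
Unset Printing Implicit Defensive.

(** * Truncated powers, and a chain rule along directions *)

(** The difference quotient stays within [|h|] of [l]. This handles the square of the positive part,
    whose two branches meet at 0. *)
Lemma is_derive_quadratic (R : realType) (f : R -> R) (x l : R) :
  (forall h, `|f (x + h) - f x - l * h| <= h ^+ 2) -> is_derive x 1 f l.
Proof.
move=> fx.
have cvgl : h^-1 *: ((f \o shift x) (h *: 1) - f x) @[h --> 0^'] --> l.
  apply/cvgrPdist_le => e e0; near=> h.
  have h0 : h != 0 by near: h; exact: nbhs_dnbhs_neq.
  have he : `|h| <= e.
    by apply: ltW; near: h; exact: dnbhs0_lt.
  rewrite /= distrC -(ler_pM2l (_ : 0 < `|h|)) ?normr_gt0//.
  rewrite -normrM mulrBr /GRing.scale/= mulrA divff// mul1r mulr1 (addrC h).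
  rewrite (mulrC h l) (le_trans (fx h))//.
  by rewrite -real_normK ?num_real// expr2 ler_wpM2l.
by apply: DeriveDef; [apply/cvg_ex; exists l|exact/cvg_lim].
Unshelve. all: by end_near. Qed.

(** Restricting [f] to the line through [x] in direction [v] reduces this to the chain rule in one
    variable. *)
Lemma is_derive_comp1 (R : realType) (V : normedModType R) (f : V -> R)
    (g : R -> R) (x v : V) (df dg : R) :
  is_derive x v f df -> is_derive (f x) 1 g dg ->
  is_derive x v (g \o f) (dg * df).
Proof.
move=> fx gx; pose c h := f (h *: v + x).
have line (k : V -> R) : 'D_v k x = 'D_1 (fun h : R => k (h *: v + x)) 0.
  rewrite /derive; set g1 := fun h => h^-1 *: _; set g2 := fun h => h^-1 *: _.
  suff -> : g1 = g2 by []; apply/funext => h; rewrite /g1 /g2 /=.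
  by rewrite [_%:A]mulr1 addr0 scale0r add0r.
have c0 : c 0 = f x by rewrite /c scale0r add0r.
case: fx gx => dfx <- [dgx <-].
have dc : derivable c 0 1 := iffLR (derivable1P f x v) dfx.
have dgc : derivable g (c 0) 1 by rewrite c0.
apply: DeriveDef.
  apply/derivable1P/derivable1_diffP.
  exact: (@differentiable_comp _ _ _ _ c g) (iffLR (derivable1_diffP _ _) dc)
    (iffLR (derivable1_diffP _ _) dgc).
by rewrite line -derive1E (derive1_comp dc dgc) !derive1E c0 -line.
Qed.

(** For [k = 0] this is the constant 1, also at negative [s]; vanishing is therefore stated for
    exponents [k.+1]. *)
Definition pospow (R : realType) (k : nat) (s : R) : R := Num.max s 0 ^+ k.

Lemma is_derive_pospow (R : realType) (k : nat) (s : R) :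
  is_derive s 1 (pospow k.+2) (k.+2%:R * pospow k.+1 s).
Proof.
elim: k s => [s|k IH s].
  apply: is_derive_quadratic => h; rewrite /pospow expr1 ler_norml.
  by case: (leP s 0) => s0; case: (leP (s + h) 0) => sh; apply/andP; split; nra.
(* The induction step is the product rule: the factor [s] agrees with its positive part wherever the
   truncated power is nonzero. *)
rewrite (_ : pospow k.+3 = id * pospow k.+2); last first.
  apply/funext => t; rewrite /pospow /GRing.mul/= exprS.
  by case: leP => // _; rewrite exprS !mul0r mulr0.
have := IH s; move=> ?; apply: is_derive_eq.
rewrite [X in _ + X]mulr1 [X in X + _](_ : _ = k.+2%:R * pospow k.+2 s).
  by rewrite -(natr1 k.+2) [RHS]mulrDl mul1r.
rewrite [LHS]mulrCA /pospow (exprS _ k.+1); case: leP => // _.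
by rewrite exprS !mul0r !mulr0.
Qed.

Lemma is_derive_pospow_comp (R : realType) (V : normedModType R) (k : nat)
    (f : V -> R) (x v : V) (df : R) :
  is_derive x v f df ->
  is_derive x v (pospow k.+2 \o f) (k.+2%:R * pospow k.+1 (f x) * df).
Proof. by move=> fx; apply: is_derive_comp1; exact: is_derive_pospow. Qed.

Lemma continuous_pospow (R : realType) (k : nat) : continuous (@pospow R k).
Proof.
move=> s.
have -> : @pospow R k = (fun t => t ^+ k) \o (id \max cst 0) by [].
apply: continuous_comp; last exact: exprn_continuous.
by apply: continuous_max => //; exact: cvg_cst.
Qed.

Lemma pospow_ge0 (R : realType) (k : nat) (s : R) : 0 <= pospow k s.
Proof. by rewrite exprn_ge0// le_max lexx orbT. Qed.

Lemma pospow_le1 (R : realType) (k : nat) (s : R) : s <= 1 -> pospow k s <= 1.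
Proof. by move=> s1; rewrite exprn_ile1 ?ge_max ?s1 ?ler01 ?le_max ?lexx ?orbT. Qed.

Lemma ler_pospow (R : realType) (j k : nat) (s : R) :
  (j <= k)%N -> s <= 1 -> pospow k s <= pospow j s.
Proof.
by move=> jk s1; rewrite ler_wiXn2l ?ge_max ?s1 ?ler01 ?le_max ?lexx ?orbT.
Qed.

Lemma pospow0 (R : realType) (k : nat) (s : R) : s <= 0 -> pospow k.+1 s = 0.
Proof. by move=> s0; rewrite /pospow max_r// expr0n. Qed.

(** * The ellipsoidal profile adapted to the dilations *)

Lemma is_derive_coord (R : realType) (n : nat) (i j : 'I_n) (x : 'rV[R]_n) :
  is_derive x (delta_mx ord0 i) (fun y => y ord0 j) (j == i)%:R.
Proof.
have dx : derivable (@id 'rV[R]_n) x (delta_mx ord0 i) := @derivable_id _ _ _ _.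
apply: DeriveDef; first by move/derivable_mxP : dx; exact.
have := derive_mx dx; rewrite derive_id => /matrixP/(_ ord0 j).
by rewrite !mxE /= => <-; rewrite eq_sym.
Qed.

(** The index [i] stands for the coordinate x_(i+1), hence the weight [i.+1]. For [r > 0] the
    profile is positive exactly on the image of the open unit ball under the dilation of factor
    [r]. *)
Definition gap (R : realType) (n : nat) (r : R) (x : 'rV[R]_n) : R :=
  1 - \sum_(i < n) (x ord0 i / r ^+ i.+1) ^+ 2.

Section gap.
Context (R : realType) (n : nat) (r : R).
Implicit Types x : 'rV[R]_n.

Lemma gapE : @gap R n r =
  cst 1 - \sum_(i < n) (fun x : 'rV_n => (r ^+ i.+1)^-1 *: x ord0 i) ^+ 2.
Proof.
apply/funext => x; rewrite /gap -[RHS]/(1 - (\sum_i _) x) fct_sumE; congr (_ - _).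
by apply: eq_bigr => i _; rewrite exprfctE/= mulrC.
Qed.

Lemma continuous_gap : continuous (@gap R n r).
Proof.
move=> x; rewrite gapE; apply: differentiable_continuous.
apply: differentiableB; first exact: differentiable_cst.
apply: differentiable_sum => i; apply: differentiableX.
by apply: differentiableZ; exact: differentiable_coord.
Qed.

Lemma is_derive_gap (i : 'I_n) x :
  is_derive x (delta_mx ord0 i) (@gap R n r)
    (- (2 * x ord0 i / (r ^+ i.+1) ^+ 2)).
Proof.
rewrite gapE.
have dX (j : 'I_n) : is_derive x (delta_mx ord0 i)
    ((fun x : 'rV_n => (r ^+ j.+1)^-1 *: x ord0 j) ^+ 2)
    ((2%:R * (((r ^+ j.+1)^-1 *: x ord0 j) ^+ 1)) *:
      ((r ^+ j.+1)^-1 *: (j == i)%:R)).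
  by apply: is_deriveX; apply: is_deriveZ; exact: is_derive_coord.
apply: is_derive_eq.
rewrite sub0r; congr (- _).
rewrite (bigD1 i)//= big1 ?addr0 => [|j /negPf ->].
  rewrite eqxx expr1 /GRing.scale/= mulr1; set c := r ^+ _.
  by rewrite -[in RHS]exprVn; ring.
by rewrite !scaler0.
Qed.

Lemma gap_le1 x : gap r x <= 1.
Proof. by rewrite gerBl sumr_ge0// => i _; exact: sqr_ge0. Qed.

Lemma gap_gt0_coord x (i : 'I_n) : 0 < r -> 0 < gap r x ->
  `|x ord0 i| <= r ^+ i.+1.
Proof.
move=> r0; rewrite subr_gt0 (bigD1 i)//= => x1.
have : (x ord0 i / r ^+ i.+1) ^+ 2 < 1.
  by apply: le_lt_trans x1; rewrite lerDl sumr_ge0// => j _; exact: sqr_ge0.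
rewrite -real_normK ?num_real// expr_lt1// normf_div => /ltW.
by rewrite (ger0_norm (exprn_ge0 _ (ltW r0))) ler_pdivrMr ?mul1r ?exprn_gt0.
Qed.

End gap.

(** * Products, and scalar multiples in the C^k norm *)

Lemma continuous_mul (R : realType) (T : topologicalType) (f g : T -> R) :
  continuous f -> continuous g -> continuous (fun x => f x * g x).
Proof. by move=> cf cg x; apply: (continuousM (cf x) (cg x)). Qed.

Lemma continuous_sub (R : realType) (T : topologicalType) (f g : T -> R) :
  continuous f -> continuous g -> continuous (fun x => f x - g x).
Proof. by move=> cf cg x; apply: (continuousB (cf x) (cg x)). Qed.

Section Ck_scale.
Context (R : realType) (n : nat).
Implicit Types g : 'rV[R]_n -> R.

Lemma partial_scale (i : 'I_n) g (c : R) :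
  (forall x, derivable g x (delta_mx ord0 i)) ->
  partial i (fun x => c * g x) = (fun x => c * partial i g x).
Proof. by move=> dg; apply/funext => x; rewrite /partial deriveZ. Qed.

Lemma Ck_scale (k : nat) g (c : R) : Ck k g -> Ck k (fun x => c * g x).
Proof.
elim: k g => [|k IH] g [cg dg].
  by split=> //; apply: continuous_mul => //; exact: cst_continuous.
split=> [|i]; first by apply: continuous_mul => //; exact: cst_continuous.
have [dgi Cgi] := dg i; split=> [x|]; first exact: (@derivableZ _ _ _ g c x _ (dgi x)).
by rewrite partial_scale//; exact: IH.
Qed.

(** The time slices of the test function and the errors of its difference quotients are multiples of
    one spatial function, so their C^2 norms are controlled by a scalar. *)
Lemma Ck_norm_le_scale (k : nat) g (c M : R) :
  Ck k g -> Ck_norm_le k g M -> Ck_norm_le k (fun x => c * g x) (`|c| * M).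
Proof.
elim: k g => [|k IH] g [_ dg] [gM dgM].
  by split=> // x; rewrite normrM ler_wpM2l.
split=> [x|i]; first by rewrite normrM ler_wpM2l.
by have [dgi Cgi] := dg i; rewrite partial_scale//; exact: IH (dgM i).
Qed.

Lemma Ck_norm_leW (k : nat) g (M N : R) :
  M <= N -> Ck_norm_le k g M -> Ck_norm_le k g N.
Proof.
move=> MN; elim: k g => [|k IH] g [gM dgM].
  by split=> // x; exact: le_trans (gM x) MN.
by split=> [x|i]; [exact: le_trans (gM x) MN|exact: IH (dgM i)].
Qed.

End Ck_scale.

(** * The spatial cutoff and the size of its derivatives *)

Definition cutoff (R : realType) (n k : nat) (r : R) (x : 'rV[R]_n) : R :=
  pospow k (gap r x).

Section cutoff.
Context (R : realType) (n : nat) (r : R).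
Implicit Types x : 'rV[R]_n.

Lemma continuous_cutoff (k : nat) : continuous (@cutoff R n k r).
Proof.
move=> x; exact: (continuous_comp (@continuous_gap _ _ r x)
  (@continuous_pospow _ k _)).
Qed.

Lemma is_derive_cutoff (k : nat) (i : 'I_n) x :
  is_derive x (delta_mx ord0 i) (@cutoff R n k.+2 r)
    (- (2 * k.+2%:R) * (x ord0 i / (r ^+ i.+1) ^+ 2) * cutoff k.+1 r x).
Proof.
have := is_derive_gap r i x => /(is_derive_pospow_comp k) dx.
by apply: is_derive_eq; rewrite /cutoff; ring.
Qed.

Lemma partial_cutoff (k : nat) (i : 'I_n) :
  partial i (@cutoff R n k.+2 r) =
  (fun x => - (2 * k.+2%:R) * (x ord0 i / (r ^+ i.+1) ^+ 2) * cutoff k.+1 r x).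
Proof. by apply/funext => x; case: (is_derive_cutoff k i x). Qed.

Lemma is_derive_partial_cutoff (k : nat) (i j : 'I_n) x :
  is_derive x (delta_mx ord0 j) (partial i (@cutoff R n k.+3 r))
    (4 * k.+3%:R * k.+2%:R * (x ord0 i / (r ^+ i.+1) ^+ 2) *
       (x ord0 j / (r ^+ j.+1) ^+ 2) * cutoff k.+1 r x
     - 2 * k.+3%:R * ((i == j)%:R / (r ^+ i.+1) ^+ 2) * cutoff k.+2 r x).
Proof.
rewrite partial_cutoff.
have d1 := is_derive_coord j i x; have d2 := is_derive_cutoff k j x.
rewrite (_ : (fun _ => _) =
  (- (2 * k.+3%:R) / (r ^+ i.+1) ^+ 2) \*:
    ((fun x => x ord0 i) * @cutoff R n k.+2 r)); last first.
  apply/funext => y; rewrite -[RHS]/(_ * (y ord0 i * cutoff k.+2 r y)).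
  by rewrite !mulrA [_ * y _ _]mulrAC.
apply: is_derive_eq; rewrite /GRing.scale/=; ring.
Qed.

Lemma partial2_cutoff (k : nat) (i j : 'I_n) :
  partial j (partial i (@cutoff R n k.+3 r)) =
  (fun x => 4 * k.+3%:R * k.+2%:R * (x ord0 i / (r ^+ i.+1) ^+ 2) *
       (x ord0 j / (r ^+ j.+1) ^+ 2) * cutoff k.+1 r x
     - 2 * k.+3%:R * ((i == j)%:R / (r ^+ i.+1) ^+ 2) * cutoff k.+2 r x).
Proof. by apply/funext => x; case: (is_derive_partial_cutoff k i j x). Qed.

Lemma continuous_monomial_cutoff (k : nat) (a : R) (i : 'I_n) :
  continuous (fun x => a * (x ord0 i / (r ^+ i.+1) ^+ 2) * cutoff k r x).
Proof.
apply: continuous_mul; last exact: continuous_cutoff.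
apply: continuous_mul; first exact: cst_continuous.
by apply: continuous_mul; [exact: coord_continuous|exact: cst_continuous].
Qed.

Lemma Ck_cutoff (k : nat) : Ck 2 (@cutoff R n k.+3 r).
Proof.
split=> [|i]; first exact: continuous_cutoff.
split=> [x|]; first by case: (is_derive_cutoff k.+1 i x).
split=> [|j].
  by rewrite partial_cutoff; exact: continuous_monomial_cutoff.
split=> [x|]; first by case: (is_derive_partial_cutoff k i j x).
rewrite partial2_cutoff; split=> //; apply: continuous_sub.
  apply: continuous_mul; last exact: continuous_cutoff.
  apply: continuous_mul.
    apply: continuous_mul; first exact: cst_continuous.
    by apply: continuous_mul; [exact: coord_continuous|exact: cst_continuous].
  by apply: continuous_mul; [exact: coord_continuous|exact: cst_continuous].
by apply: continuous_mul; [exact: cst_continuous|exact: continuous_cutoff].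
Qed.

Lemma cutoff_ge0 (k : nat) x : 0 <= cutoff k r x.
Proof. exact: pospow_ge0. Qed.

Lemma cutoff_le1 (k : nat) x : cutoff k r x <= 1.
Proof. exact/pospow_le1/gap_le1. Qed.

Lemma ler_cutoff (j k : nat) x : (j <= k)%N -> cutoff k r x <= cutoff j r x.
Proof. by move=> jk; apply: ler_pospow => //; exact: gap_le1. Qed.

Lemma cutoff_neq0_coord (k : nat) x (i : 'I_n) : 0 < r ->
  cutoff k.+1 r x != 0 -> `|x ord0 i| <= r ^+ i.+1.
Proof.
move=> r0; apply: contra_neqT; rewrite -ltNge => xr; apply: pospow0.
by rewrite leNgt; apply/negP => /(gap_gt0_coord i r0); rewrite leNgt xr.
Qed.

Hypothesis r0 : 0 < r.
Let L0 (i : nat) : 0 < r ^+ i. Proof. exact: exprn_gt0. Qed.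

(** Where the cutoff is nonzero, the coordinate is at most [r ^+ i.+1] in absolute value; elsewhere
    both sides are 0. Each factor produced by differentiating in direction [i] thus costs one
    inverse weight. *)
Lemma coord_cutoff (k : nat) (i : 'I_n) x :
  `|x ord0 i / (r ^+ i.+1) ^+ 2| * cutoff k.+1 r x <=
  (r ^+ i.+1)^-1 * cutoff k.+1 r x.
Proof.
have [->|/(cutoff_neq0_coord i r0) xi] := eqVneq (cutoff k.+1 r x) 0.
  by rewrite !mulr0.
rewrite ler_wpM2r ?cutoff_ge0// normf_div (ger0_norm (sqr_ge0 _)).
by rewrite ler_pdivrMr ?exprn_gt0// expr2 mulrA mulVf ?mul1r// gt_eqF.
Qed.

Lemma partial_cutoff_le (k : nat) (i : 'I_n) x :
  `|partial i (@cutoff R n k.+2 r) x| <=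
  2 * k.+2%:R * (r ^+ i.+1)^-1 * cutoff k.+1 r x.
Proof.
rewrite partial_cutoff 2!normrM normrN (ger0_norm (cutoff_ge0 _ _)).
rewrite (@ger0_norm _ (2 * _))// -[leLHS]mulrA -[leRHS]mulrA.
by rewrite ler_wpM2l// coord_cutoff.
Qed.

Lemma partial2_cutoff_le (k : nat) (i j : 'I_n) x :
  `|partial j (partial i (@cutoff R n k.+3 r)) x| <=
  6 * k.+3%:R ^+ 2 * ((r ^+ i.+1)^-1 * (r ^+ j.+1)^-1) * cutoff k.+1 r x.
Proof.
rewrite partial2_cutoff (le_trans (ler_normB _ _))//.
set c := cutoff k.+1 r x; have c0 : 0 <= c by exact: cutoff_ge0.
set a := (r ^+ i.+1)^-1; set b := (r ^+ j.+1)^-1.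
have [a0 b0] : 0 < a /\ 0 < b by rewrite !invr_gt0.
have ac : `|x ord0 i / (r ^+ i.+1) ^+ 2| * c <= a * c := coord_cutoff _ _ _.
have bc : `|x ord0 j / (r ^+ j.+1) ^+ 2| * c <= b * c := coord_cutoff _ _ _.
have K0 : (0 : R) <= k%:R by exact: ler0n.
have E1 : k.+3%:R = k%:R + 3 :> R by rewrite -(natrD _ k 3) addn3.
have E2 : k.+2%:R = k%:R + 2 :> R by rewrite -(natrD _ k 2) addn2.
(* The 4 pays for the product of two first-order factors, the 2 for the diagonal term, which is
   nonzero only if [i = j], and then [a = b]. *)
have -> : 6 * k.+3%:R ^+ 2 * (a * b) * c =
  4 * k.+3%:R ^+ 2 * (a * b * c) + 2 * k.+3%:R ^+ 2 * (a * b * c) by ring.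
apply: lerD.
  rewrite 3!normrM (ger0_norm c0) (@ger0_norm _ (4 * _ * _))//.
  apply: (@le_trans _ _ (4 * k.+3%:R * k.+2%:R * (a * b * c))).
    rewrite -2!mulrA ler_wpM2l// (le_trans (ler_wpM2l _ bc))//.
    by rewrite mulrCA (mulrC a) -mulrA ler_wpM2l ?(ltW b0)// mulrC.
  rewrite ler_wpM2r ?mulr_ge0 ?(ltW a0) ?(ltW b0)// E1 E2; nra.
rewrite 2!normrM (@ger0_norm _ (2 * _))//.
rewrite (ger0_norm (cutoff_ge0 _ _)).
apply: (@le_trans _ _ (2 * k.+3%:R * (a * b * c))); last first.
  by rewrite ler_wpM2r ?mulr_ge0 ?(ltW a0) ?(ltW b0)// E1; nra.
rewrite -mulrA ler_wpM2l//; apply: ler_pM => //; last exact: ler_cutoff.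
  by rewrite cutoff_ge0.
rewrite normrM; have [ij|_] := eqVneq i j; last first.
  by rewrite normr0 mul0r mulr_ge0 ?ltW.
by rewrite normr1 mul1r /b -ij expr2 invfM ger0_norm// mulr_ge0 ?(ltW a0).
Qed.

End cutoff.

(** * The operator Delta_X and its action on the cutoff *)

Section laplacian.
Context (R : realType) (n : nat).
Implicit Types (x : 'rV[R]_n.+1) (g : 'rV[R]_n.+1 -> R).

Lemma is_derive_field2 (i j : 'I_n.+1) x : j != ord0 ->
  is_derive x (delta_mx ord0 j) (fun y => field2 y ord0 i) 0.
Proof.
move=> j0; rewrite (_ : (fun _ => _) =
    if i == ord0 then cst 0 else (fun y : 'rV[R]_n.+1 => y ord0 ord0) ^+ i); last first.
  apply/funext => y; rewrite mxE; case: ifP => // _.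
  by rewrite exprfctE.
case: ifP => _; first exact: is_derive_cst.
have := is_derive_coord j ord0 x; rewrite eq_sym (negPf j0) => d.
by apply: is_derive_eq; rewrite scaler0.
Qed.

(** The coefficients of X_2 depend on x_1 alone, and its coefficient along x_1 is 0. Hence the
    adjoint of each field is its negative. *)
Lemma divergence_fields (k : 'I_2) x : divergence (@fields R n k) x = 0.
Proof.
rewrite /divergence big1// => i _; rewrite /partial /fields.
case: ifP => _; first by rewrite derive_cst.
have [->|i0] := eqVneq i ord0; last by case: (is_derive_field2 i x i0).
rewrite (_ : (fun _ => _) = cst 0) ?derive_cst//.
by apply/funext => y; rewrite mxE.
Qed.

Lemma vf_apply_field1 g : vf_apply (@field1 R n) g = partial ord0 g.
Proof.
apply/funext => x; rewrite /vf_apply (bigD1 ord0)//= big1 => [|i i0].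
  by rewrite mxE !eqxx mul1r addr0.
by rewrite mxE (negPf i0) mul0r.
Qed.

Lemma partial_vf_apply_field2 g (j : 'I_n.+1) x : Ck 2 g -> j != ord0 ->
  partial j (vf_apply (@field2 R n) g) x =
  \sum_(i < n.+1) field2 x ord0 i * partial j (partial i g) x.
Proof.
move=> [_ dg] j0.
have di (i : 'I_n.+1) : is_derive x (delta_mx ord0 j)
    ((fun y => field2 y ord0 i) * partial i g)
    (field2 x ord0 i * partial j (partial i g) x).
  have d1 := is_derive_field2 i x j0.
  have d2 : is_derive x (delta_mx ord0 j) (partial i g)
      (partial j (partial i g) x).
    by apply: derivableP; have [_ [_ /(_ j)[]]] := dg i.
  by apply: is_derive_eq; rewrite /GRing.scale/= mulr0 addr0.
rewrite {1}/partial (_ : vf_apply _ _ =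
  \sum_(i < n.+1) ((fun y => field2 y ord0 i) * partial i g)).
  by rewrite derive_val.
by apply/funext => y; rewrite /vf_apply fct_sumE.
Qed.

(** No first-order terms appear: X_2 differentiates only in directions other than x_1, along which
    its own coefficients are constant. *)
Lemma vf_laplacian_fields g x : Ck 2 g ->
  vf_laplacian (@fields R n) g x =
  partial ord0 (partial ord0 g) x +
  \sum_(j < n.+1) \sum_(i < n.+1)
    field2 x ord0 j * (field2 x ord0 i * partial j (partial i g) x).
Proof.
move=> Cg; rewrite /vf_laplacian -sumrN big_ord_recl big_ord1 /vf_adjoint.
rewrite !divergence_fields !mul0r !subr0 !opprK /fields/= !vf_apply_field1.
congr (_ + _); rewrite {1}/vf_apply; apply: eq_bigr => j _.
(* In direction x_1 the coefficients of X_2 do vary, but there the outer coefficient is 0. *)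
rewrite -mulr_sumr; have [->|j0] := eqVneq j ord0.
  by rewrite mxE /= !mul0r.
by rewrite partial_vf_apply_field2.
Qed.

Lemma vf_laplacian_scale g (c : R) x : Ck 2 g ->
  vf_laplacian (@fields R n) (fun y => c * g y) x =
  c * vf_laplacian (@fields R n) g x.
Proof.
move=> Cg.
rewrite (vf_laplacian_fields x Cg) (vf_laplacian_fields x (Ck_scale c Cg)).
case: Cg => _ dg.
have E i j : partial j (partial i (fun y => c * g y)) x =
    c * partial j (partial i g) x.
  have [dgi [_ /(_ j)[dgij _]]] := dg i.
  by rewrite (partial_scale c dgi) (partial_scale c dgij).
rewrite E mulrDr mulr_sumr; congr (_ + _); apply: eq_bigr => j _.
by rewrite mulr_sumr; apply: eq_bigr => i _; rewrite E; ring.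
Qed.

(* The weights of the cutoff match the dilations for which both fields are
   homogeneous of degree one, hence the factor [r ^- 2]. *)
Lemma vf_laplacian_cutoff_le (k : nat) (r : R) x : 0 < r ->
  `|vf_laplacian (@fields R n) (cutoff k.+3 r) x| <=
  6 * k.+3%:R ^+ 2 * (1 + n.+1%:R ^+ 2) * r ^- 2 * cutoff k.+1 r x.
Proof.
move=> r0; rewrite vf_laplacian_fields; last exact: Ck_cutoff.
set M := 6 * k.+3%:R ^+ 2 * r ^- 2 * cutoff k.+1 r x.
have M0 : 0 <= M by rewrite !mulr_ge0 ?cutoff_ge0 ?invr_ge0 ?sqr_ge0.
(* One copy of [M] bounds X_1^2, and one more bounds each summand of the double sum for X_2^2. *)
have -> : 6 * k.+3%:R ^+ 2 * (1 + n.+1%:R ^+ 2) * r ^- 2 * cutoff k.+1 r x =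
    M + \sum_(j < n.+1) \sum_(i < n.+1) M.
  rewrite !sumr_const card_ord -mulrnA -[M *+ _]mulr_natr natrM /M; ring.
rewrite (le_trans (ler_normD _ _))// lerD//.
  have := partial2_cutoff_le r0 k ord0 ord0 x.
  by rewrite expr1 -expr2 exprVn.
rewrite (le_trans (ler_norm_sum _ _ _))// ler_sum// => j _.
rewrite (le_trans (ler_norm_sum _ _ _))// ler_sum// => i _.
(* On the support [|x_1| <= r], so the coefficient x_1^l is at most r^l, against a weight r^(l+1):
   each application of X_2 gains r^(-1). *)
have fle (l : 'I_n.+1) : cutoff k.+1 r x != 0 ->
    `|field2 x ord0 l| * (r ^+ l.+1)^-1 <= r^-1.
  move=> /(cutoff_neq0_coord ord0 r0); rewrite expr1 => x0.
  rewrite mxE; case: ifP => _; first by rewrite normr0 mul0r invr_ge0 ltW.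
  rewrite normrX ler_pdivrMr ?exprn_gt0// exprS mulrA mulVf ?gt_eqF// mul1r.
  by rewrite lerXn2r ?nnegrE ?normr_ge0 ?(ltW r0).
have [c0|c0] := eqVneq (cutoff k.+1 r x) 0.
  have := partial2_cutoff_le r0 k i j x.
  by rewrite c0 mulr0 normr_le0 => /eqP ->; rewrite !mulr0 normr0.
rewrite !normrM; apply: (@le_trans _ _ (`|field2 x ord0 j| *
  (`|field2 x ord0 i| * (6 * k.+3%:R ^+ 2 *
    ((r ^+ i.+1)^-1 * (r ^+ j.+1)^-1) * cutoff k.+1 r x)))).
  by rewrite !ler_wpM2l// partial2_cutoff_le.
set a := _^-1; set b := (r ^+ j.+1)^-1.
have -> : `|field2 x ord0 j| * (`|field2 x ord0 i| *
   (6 * k.+3%:R ^+ 2 * (a * b) * cutoff k.+1 r x)) =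
   6 * k.+3%:R ^+ 2 * ((`|field2 x ord0 j| * b) * (`|field2 x ord0 i| * a))
   * cutoff k.+1 r x by ring.
rewrite /M ler_wpM2r ?cutoff_ge0// ler_wpM2l ?mulr_ge0 ?sqr_ge0//.
rewrite -exprVn expr2 ler_pM ?fle// mulr_ge0 ?invr_ge0 ?exprn_ge0// ltW//.
Qed.

End laplacian.

(** * The cutoff in time *)

Definition time_cutoff (R : realType) (k : nat) (T t : R) : R :=
  pospow k (1 - ((t - 2 * T) / T) ^+ 2).

(** The index is that of the surviving power: for [k] positive this is the derivative of
    [time_cutoff k.+1]. *)
Definition time_cutoff' (R : realType) (k : nat) (T t : R) : R :=
  - (2 * k.+1%:R) * ((t - 2 * T) / T / T) * time_cutoff k T t.

Section time_cutoff.
Context (R : realType) (T : R).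
Hypothesis T0 : 0 < T.
Implicit Types t : R.

Let gap1 t : 1 - ((t - 2 * T) / T) ^+ 2 <= 1.
Proof. by rewrite gerBl sqr_ge0. Qed.

Lemma is_derive_time_cutoff (k : nat) t :
  is_derive t 1 (time_cutoff k.+2 T) (time_cutoff' k.+1 T t).
Proof.
have d : is_derive t 1 (cst 1 - (T^-1 \*: (id - cst (2 * T))) ^+ 2)
    (- (2 * ((t - 2 * T) / T) / T)).
  apply: is_derive_eq; rewrite /GRing.scale/=.
  by rewrite -[(id - cst (2 * T)) t]/(t - 2 * T) -[_ *: _]/(T^-1 * _); ring.
have := is_derive_pospow_comp k d.
rewrite (_ : _ \o _ = time_cutoff k.+2 T); last first.
  apply/funext => s; rewrite /time_cutoff /= -[(_ - _) s]/(1 - (T^-1 * (s - _)) ^+ 2).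
  by rewrite mulrC.
rewrite -[(_ - _) t]/(1 - (T^-1 * (t - _)) ^+ 2) => ds.
by apply: is_derive_eq; rewrite /time_cutoff' /time_cutoff (mulrC T^-1); ring.
Qed.

Lemma continuous_time_cutoff (k : nat) : continuous (time_cutoff k T).
Proof.
have cg : continuous (fun t => 1 - ((t - 2 * T) / T) ^+ 2).
  apply: continuous_sub; first exact: cst_continuous.
  apply: continuous_mul; apply: continuous_mul; try exact: cst_continuous.
    by apply: continuous_sub; [by move=> s; exact: cvg_id|exact: cst_continuous].
  by apply: continuous_sub; [by move=> s; exact: cvg_id|exact: cst_continuous].
by move=> t; exact: (continuous_comp (cg t) (@continuous_pospow _ k _)).
Qed.

Lemma continuous_time_cutoff' (k : nat) : continuous (time_cutoff' k T).
Proof.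
apply: continuous_mul; last exact: continuous_time_cutoff.
apply: continuous_mul; first exact: cst_continuous.
apply: continuous_mul; last exact: cst_continuous.
apply: continuous_mul; last exact: cst_continuous.
by apply: continuous_sub; [by move=> s; exact: cvg_id|exact: cst_continuous].
Qed.

Lemma time_cutoff_ge0 (k : nat) t : 0 <= time_cutoff k T t.
Proof. exact: pospow_ge0. Qed.

Lemma time_cutoff_le1 (k : nat) t : time_cutoff k T t <= 1.
Proof. exact: pospow_le1. Qed.

Lemma ler_time_cutoff (j k : nat) t :
  (j <= k)%N -> time_cutoff k T t <= time_cutoff j T t.
Proof. by move=> jk; apply: ler_pospow. Qed.

Lemma time_cutoff_neq0 (k : nat) t :
  time_cutoff k.+1 T t != 0 -> `|t - 2 * T| <= T.
Proof.
apply: contra_neqT; rewrite -ltNge => tT; apply: pospow0.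
rewrite subr_le0 -real_normK ?num_real// expr_ge1// normf_div (gtr0_norm T0).
by rewrite ler_pdivlMr ?mul1r ?ltW.
Qed.

(** On the support [|t - 2 * T| <= T], so the derivative of the profile under the power is at most
    [2 / T] in absolute value. *)
Lemma time_cutoff'_le (k : nat) t :
  `|time_cutoff' k.+1 T t| <= 2 * k.+2%:R / T * time_cutoff k.+1 T t.
Proof.
rewrite /time_cutoff' 2!normrM normrN (ger0_norm (time_cutoff_ge0 _ _)).
rewrite (@ger0_norm _ (2 * _))//.
have [->|/time_cutoff_neq0 tT] := eqVneq (time_cutoff k.+1 T t) 0.
  by rewrite !mulr0.
rewrite ler_wpM2r ?time_cutoff_ge0// ler_wpM2l// !normf_div (gtr0_norm T0).
by rewrite ler_pdivrMr// mulVf ?gt_eqF// ler_pdivrMr ?mul1r.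
Qed.

(* [3/4 = 1 - (1/2)^2]. *)
Lemma time_cutoff_lower (k : nat) t :
  3 / 2 * T <= t <= 5 / 2 * T -> (3 / 4) ^+ k <= time_cutoff k T t.
Proof.
move=> /andP[t1 t2].
have h : ((t - 2 * T) / T) ^+ 2 <= (1 / 2) ^+ 2.
  rewrite -real_normK ?num_real// lerXn2r ?nnegrE//.
  rewrite normf_div (gtr0_norm T0) ler_pdivrMr// ler_norml.
  by apply/andP; split; lra.
rewrite /time_cutoff /pospow lerXn2r ?nnegrE ?le_max ?lexx ?orbT//.
by apply/orP; left; lra.
Qed.

End time_cutoff.

(** * The product of the cutoffs is an admissible test function *)

(** A product of intervals containing the ellipsoid, so that compactness and volume can be treated
    coordinate by coordinate. *)
Definition box (R : realType) (n : nat) (r : R) : set 'rV[R]_n :=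
  [set x : 'rV[R]_n | forall i : 'I_n, x ord0 i \in `[- r ^+ i.+1, r ^+ i.+1]].

Lemma compact_box (R : realType) (n : nat) (r : R) : compact (@box R n r).
Proof.
apply: (@rV_compact _ n (fun i => [set` `[- r ^+ i.+1, r ^+ i.+1]])) => i.
exact: segment_compact.
Qed.

Lemma cutoff_neq0_box (R : realType) (n k : nat) (r : R) (x : 'rV[R]_n) :
  0 < r -> cutoff k.+1 r x != 0 -> box r x.
Proof.
move=> r0 cx i; rewrite in_itv/= -ler_norml.
exact: cutoff_neq0_coord cx.
Qed.

Section test_function_cutoff.
Context (R : realType) (n k : nat) (r T : R).
Hypotheses (r1 : 1 <= r) (T0 : 0 < T).

Let r0 : 0 < r. Proof. exact: lt_le_trans r1. Qed.

(** Since [1 <= r], all inverse weights are at most 1, and the constant of the second-order bound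
    dominates those of lower order. *)
Lemma Ck_norm_le_cutoff :
  Ck_norm_le 2 (@cutoff R n k.+3 r) (6 * k.+3%:R ^+ 2).
Proof.
have k1 : 1 <= k.+3%:R :> R by rewrite ler1n.
have rV (i : nat) : 0 <= (r ^+ i)^-1 <= 1.
  by rewrite invr_ge0 exprn_ge0 ?(ltW r0)//= invf_le1 ?exprn_gt0// exprn_ege1.
have [rV0 rV1] : (forall i, 0 <= (r ^+ i)^-1) /\ (forall i, (r ^+ i)^-1 <= 1).
  by split=> i; case/andP: (rV i).
split=> [x|i].
  by rewrite ger0_norm ?cutoff_ge0// (le_trans (cutoff_le1 _ _ _))//; nra.
split=> [x|j].
  rewrite (le_trans (partial_cutoff_le r0 _ _ _))//.
  apply: (@le_trans _ _ (2 * k.+3%:R * 1 * 1)); last by nra.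
  by apply: ler_pM; rewrite ?cutoff_ge0 ?cutoff_le1 ?mulr_ge0 ?ler_wpM2l ?rV0 ?rV1.
split=> // x; rewrite (le_trans (partial2_cutoff_le r0 _ _ _ _))//.
rewrite -[leRHS]mulr1 -mulrA ler_wpM2l ?mulr_ge0 ?sqr_ge0// -[leRHS]mulr1.
apply: ler_pM; rewrite ?mulr_ge0 ?cutoff_ge0 ?cutoff_le1 ?rV0//.
by rewrite -[leRHS]mulr1 ler_pM ?rV0 ?rV1.
Qed.

(** With the spatial factor fixed, being C^1 in time with values in C^2_K reduces to the scalar time
    factor being C^1. The exponent [k.+3] makes the spatial factor C^2. *)
Lemma test_function_cutoff : test_function +oo
  (fun t x => time_cutoff k.+3 T t * @cutoff R n k.+3 r x)
  (fun t x => time_cutoff' k.+2 T t * @cutoff R n k.+3 r x).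
Proof.
have supp (c : R) : Ck_supported 2 (@box R n r) (fun x => c * cutoff k.+3 r x).
  split; first exact/Ck_scale/Ck_cutoff.
  have cb : closed (@box R n r).
    by apply: compact_closed; [exact: norm_hausdorff|exact: compact_box].
  rewrite [X in _ `<=` X]((closure_id _).1 cb).
  apply: closure_subset => x /=; rewrite mulf_eq0 negb_or => /andP[_].
  exact: cutoff_neq0_box.
set M : R := 6 * k.+3%:R ^+ 2.
have M0 : 0 < M by rewrite mulr_gt0// exprn_gt0.
have small (c e : R) : `|c| <= e / M ->
    Ck_norm_le 2 (fun x => c * @cutoff R n k.+3 r x) e.
  rewrite ler_pdivlMr// => ce; apply: (Ck_norm_leW ce).
  by apply: Ck_norm_le_scale; [exact: Ck_cutoff|exact: Ck_norm_le_cutoff].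
split.
- by exists (box r); [exact: compact_box|move=> t _; split].
(* The time factor is supported in the interval from [T] to [3 * T]. *)
- exists (3 * T) => [|t _ tT x]; first exact: ltry.
  apply/eqP; rewrite mulf_eq0; apply/orP; left; apply/negPn/negP.
  by move=> /(time_cutoff_neq0 T0); rewrite ler_norml => /andP[_]; lra.
- move=> t _ e e0; have [dt Dt] := is_derive_time_cutoff T k.+1 t.
  have /cvgrPdist_le/(_ _ (divr_gt0 e0 M0)) [d d0 Hd] := dt.
  exists d => // s ts st _.
  rewrite (_ : (fun _ => _) = (fun x => ((time_cutoff k.+3 T s -
    time_cutoff k.+3 T t) / (s - t) - time_cutoff' k.+2 T t) * cutoff k.+3 r x)).
    apply: small; have := Hd (s - t); rewrite /= sub0r opprB => /(_ ts).
    rewrite subr_eq0 => /(_ st); rewrite -[X in `|X - _|]/('D_1 (time_cutoff k.+3 T) t) Dt.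
    by rewrite distrC /GRing.scale/= mulr1 subrK mulrC.
  by apply/funext => x; ring.
- move=> t _ e e0.
  have /cvgrPdist_le/(_ _ (divr_gt0 e0 M0)) [d d0 Hd] :=
    @continuous_time_cutoff' _ T k.+2 t.
  exists d => // s ts _.
  rewrite (_ : (fun _ => _) = (fun x => (time_cutoff' k.+2 T s -
    time_cutoff' k.+2 T t) * cutoff k.+3 r x)).
    by apply: small; rewrite distrC; exact: Hd.
  by apply/funext => x; ring.
Qed.

End test_function_cutoff.

(** * Volume of boxes, and the mass of [f] seen by large cutoffs *)

Section measure.
Context (R : realType) (n : nat).
Implicit Types x : 'rV[R]_n.

Lemma measurable_gap (r : R) : measurable_fun setT (@gap R n r).
Proof.
apply: measurable_funB; first exact: measurable_cst.
apply: measurable_sum => i; apply: measurable_funX; apply: measurable_funM.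
  exact: measurable_rV_coord.
exact: measurable_cst.
Qed.

Lemma measurable_cutoff (k : nat) (r : R) :
  measurable_fun setT (@cutoff R n k r).
Proof.
apply: (measurableT_comp (f := @pospow R k)); last exact: measurable_gap.
by apply: continuous_measurable_fun; exact: continuous_pospow.
Qed.

Lemma measurable_box (r : R) : measurable (@box R n r).
Proof.
rewrite (_ : box r = \bigcap_(i in [set: 'I_n])
    ((fun x => x ord0 i) @^-1` [set` `[- r ^+ i.+1, r ^+ i.+1]])).
  apply: fin_bigcap_measurable => // i _.
  rewrite -[X in measurable X]setTI; apply: measurable_rV_coord => //.
by apply/seteqP; split=> x /= xr => [i _|i]; exact: xr.
Qed.

(** The exact exponent n (n + 1) / 2 is traded for 2^n - 1, the numerator in the bound on p in
    dimension n. The induction step rests on m + 1 <= 2^m. *)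
Lemma lebesgue_rV_box_le (r : R) : 1 <= r ->
  (lebesgue_rV n (box r) <= (2 ^+ n * r ^+ (2 ^ n).-1)%:E)%E.
Proof.
move=> r1; have r0 : 0 < r := lt_le_trans ltr01 r1.
rewrite (@lebesgue_rV_box _ _ (fun i => [set` `[- r ^+ i.+1, r ^+ i.+1]]))//.
rewrite (eq_bigr (fun i : 'I_n => (2 * r ^+ i.+1)%:E)) => [|i _]; last first.
  rewrite lebesgue_measure_itv/= lte_fin gtrN ?exprn_gt0//.
  by rewrite -EFinB opprK mulr_natl mulr2n.
rewrite prodEFin lee_fin; elim: n => [|m IH].
  by rewrite big_ord0 !expr0 mulr1.
rewrite big_ord_recr/=.
apply: (@le_trans _ _ (2 ^+ m * r ^+ (2 ^ m).-1 * (2 * r ^+ m.+1))).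
  by rewrite ler_wpM2r// mulr_ge0// exprn_ge0// ltW.
rewrite mulrACA -exprSr -exprD ler_wpM2l ?mulr_ge0 ?exprn_ge0// ler_weXn2l//.
by have := ltn_expl m (ltnSn 1); rewrite expnS; lia.
Qed.

Lemma integrable_mul_cutoff (f : 'rV[R]_n -> R) (k : nat) (r : R) :
  L1loc f -> 0 < r ->
  (lebesgue_rV n).-integrable setT (fun x => (f x * cutoff k.+1 r x)%:E).
Proof.
move=> [mf If] r0; apply/integrableP; split.
  by apply/measurable_EFinP/measurable_funM => //; exact: measurable_cutoff.
apply: le_lt_trans (If _ (@compact_box R n r)).
rewrite [leRHS]integral_mkcond; apply: ge0_le_integral => //.
- apply: measurableT_comp => //; apply/measurable_EFinP.
  by apply: measurable_funM => //; exact: measurable_cutoff.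
- apply/(measurable_restrictT _ (measurable_box r)).
  by apply/measurable_funTS/measurable_EFinP; exact: measurableT_comp.
- move=> x _; rewrite /patch; case: ifPn => [_|].
    rewrite abse_EFin lee_fin normrM -[leRHS]mulr1 ler_wpM2l//.
    by rewrite ger0_norm ?cutoff_le1 ?cutoff_ge0.
  rewrite notin_setE => xr; have [->|/(cutoff_neq0_box r0)//] :=
    eqVneq (cutoff k.+1 r x) 0.
  by rewrite mulr0 abse0.
Qed.

Lemma cutoff_nondecreasing (k i j : nat) x : (i <= j)%N ->
  cutoff k i.+1%:R x <= cutoff k j.+1%:R x.
Proof.
move=> ij; rewrite /cutoff /pospow; apply: lerXn2r.
- by rewrite nnegrE le_max lexx orbT.
- by rewrite nnegrE le_max lexx orbT.
rewrite ge_max !le_max lexx orbT andbT; apply/orP; left.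
rewrite /gap lerB// ler_sum// => l _.
rewrite !expr_div_n ler_wpM2l ?sqr_ge0// lef_pV2 ?posrE ?exprn_gt0//.
by rewrite -!exprM lerXn2r ?nnegrE// ler_nat.
Qed.

(** In the variable h = 1/r the cutoff is a truncated power of a polynomial, continuous at h = 0
    with value 1; the radii [j.+1] correspond to [harmonic]. *)
Lemma cutoff_cvg1 (k : nat) x : cutoff k j.+1%:R x @[j --> \oo] --> (1 : R).
Proof.
pose g (h : R) := pospow k (1 - \sum_(i < n) (x ord0 i * h ^+ i.+1) ^+ 2).
have cg : continuous g.
  pose p : {poly R} := \sum_(i < n) (x ord0 i *: ('X ^+ i.+1)) ^+ 2.
  have cs : continuous (fun h => 1 - horner p h).
    by apply: continuous_sub; [exact: cst_continuous|exact: continuous_horner].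
  rewrite (_ : g = @pospow R k \o (fun h => 1 - horner p h)).
    by move=> h; exact: (continuous_comp (cs h) (@continuous_pospow _ k _)).
  apply/funext => h; rewrite /g /p /= horner_sum; congr (pospow k (1 - _)).
  by apply: eq_bigr => i _; rewrite horner_exp hornerZ hornerXn.
have g0 : g 0 = 1.
  rewrite /g big1 => [|i _]; last by rewrite expr0n mulr0 expr0n.
  by rewrite subr0 /pospow max_l// expr1n.
rewrite -[X in _ --> X]g0 (_ : (fun j => _) = g \o harmonic).
  exact: (continuous_cvg _ (cg 0) cvg_harmonic).
apply/funext => j; rewrite /cutoff /g /gap /harmonic/=; congr (pospow k (1 - _)).
by apply: eq_bigr => i _; rewrite exprVn.
Qed.

(** Positivity of the extended integral forces the negative part of [f] to have finite integral [N],
    while the positive part may have infinite integral. Monotone convergence brings the truncated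
    positive part above [N], and truncation only decreases the negative part. *)
Lemma mass_cutoff_ge (f : 'rV[R]_n -> R) (k : nat) : L1loc f ->
  (0 < \int[lebesgue_rV n]_x (f x)%:E)%E ->
  exists2 e : R, 0 < e & exists j0, forall j, (j0 <= j)%N ->
    (e%:E <= \int[lebesgue_rV n]_x (f x * cutoff k.+1 j.+1%:R x)%:E)%E.
Proof.
move=> Lf; have mf := Lf.1; set nu := lebesgue_rV n.
pose fp x := Num.max (f x) 0; pose fm x := Num.max (- f x) 0.
have fp0 x : 0 <= fp x by rewrite le_max lexx orbT.
have fm0 x : 0 <= fm x by rewrite le_max lexx orbT.
have fE x : f x = fp x - fm x.
  by rewrite /fp /fm; case: (leP (f x) 0); case: (leP (- f x) 0); lra.
have mfp : measurable_fun setT fp.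
  by apply: measurable_maxr => //; exact: measurable_cst.
have mfm : measurable_fun setT fm.
  by apply: measurable_maxr; [exact: measurableT_comp|exact: measurable_cst].
have ig (g : 'rV[R]_n -> R) j : measurable_fun setT g ->
    (forall x, `|g x| <= `|f x|) ->
    nu.-integrable setT (fun x => (g x * cutoff k.+1 j.+1%:R x)%:E).
  move=> mg gf.
  apply: le_integrable (integrable_mul_cutoff k Lf (ltr0Sn R j)) => //.
    by apply/measurable_EFinP/measurable_funM => //; exact: measurable_cutoff.
  by move=> x _; rewrite !abse_EFin lee_fin !normrM ler_wpM2r.
have igp j : nu.-integrable setT (fun x => (fp x * cutoff k.+1 j.+1%:R x)%:E).
  apply: ig => // x; rewrite ger0_norm// /fp; case: (leP (f x) 0) => // h.
  by rewrite ler_norm.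
have igm j : nu.-integrable setT (fun x => (fm x * cutoff k.+1 j.+1%:R x)%:E).
  apply: ig => // x; rewrite ger0_norm// /fm; case: (leP (- f x) 0) => // h.
  by rewrite -normrN ler_norm.
have IE j : (\int[nu]_x (f x * cutoff k.+1 j.+1%:R x)%:E =
    \int[nu]_x (fp x * cutoff k.+1 j.+1%:R x)%:E -
    \int[nu]_x (fm x * cutoff k.+1 j.+1%:R x)%:E)%E.
  rewrite -integralB//; apply: eq_integral => x _.
  by rewrite -EFinB -mulrBl -fE.
rewrite integralE (_ : (fun x => (f x)%:E)^\+%E = EFin \o fp); last first.
  by apply/funext => x; rewrite funeposE -EFin_max.
rewrite (_ : (fun x => (f x)%:E)^\-%E = EFin \o fm); last first.
  by apply/funext => x; rewrite funenegE -EFinN -EFin_max.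
rewrite sube_gt0 => NP; set N := (\int[_]_x _)%E in NP.
have Ngt j : (\int[nu]_x (fm x * cutoff k.+1 j.+1%:R x)%:E <= N)%E.
  apply: ge0_le_integral => //.
  - by move=> x _; rewrite lee_fin mulr_ge0// cutoff_ge0.
  - by apply/measurable_EFinP/measurable_funM => //; exact: measurable_cutoff.
  - exact/measurable_EFinP.
  - by move=> x _; rewrite lee_fin -[leRHS]mulr1 ler_wpM2l ?cutoff_le1.
have Nfin : N \is a fin_num.
  rewrite ge0_fin_numE; first exact: lt_le_trans NP (leey _).
  by apply: integral_ge0 => x _; rewrite lee_fin.
pose G j := (\int[nu]_x (fp x * cutoff k.+1 j.+1%:R x)%:E)%E.
have ndG i j : (i <= j)%N -> (G i <= G j)%E.
  move=> ij; apply: ge0_le_integral => //.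
  - by move=> x _; rewrite lee_fin mulr_ge0// cutoff_ge0.
  - by apply/measurable_EFinP/measurable_funM => //; exact: measurable_cutoff.
  - by apply/measurable_EFinP/measurable_funM => //; exact: measurable_cutoff.
  - by move=> x _; rewrite lee_fin ler_wpM2l// cutoff_nondecreasing.
have [j0 Gj0] : exists j, (N < G j)%E.
  apply/not_existsP => GN.
  suff : (\int[nu]_x (EFin \o fp) x <= N)%E by rewrite leNgt NP.
  have mono : (fun j => G j) @ \oo --> (\int[nu]_x
      (fun x => limn (fun j => (fp x * cutoff k.+1 j.+1%:R x)%:E)) x)%E.
    apply: cvg_monotone_convergence => //.
    - move=> j; apply/measurable_EFinP/measurable_funM => //.
      exact: measurable_cutoff.
    - by move=> j x _; rewrite lee_fin mulr_ge0// cutoff_ge0.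
    - move=> x _ i j ij.
      by rewrite lee_fin ler_wpM2l// cutoff_nondecreasing.
  rewrite (eq_integral (fun x =>
      limn (fun j => (fp x * cutoff k.+1 j.+1%:R x)%:E))) => [|x _].
    rewrite -(cvg_lim _ mono)//; apply: lime_le; first by apply/cvg_ex; eexists; exact: mono.
    by near=> j; rewrite leNgt; apply/negP; exact: GN.
  apply/esym/cvg_lim => //; apply: cvg_EFin; first exact: nearW.
  rewrite -[X in _ --> X]mulr1.
  by apply: cvgM; [exact: cvg_cst|exact: cutoff_cvg1].
have Gfin j : G j \is a fin_num by exact: integrable_fin_num.
(* The margin reached at [j0] persists: [G] increases with the radius, and [N] bounds the truncated
   negative part at every radius. *)
exists (fine (G j0) - fine N).
  by rewrite subr_gt0 -lte_fin !fineK.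
exists j0 => j j0j; rewrite IE EFinB !fineK//.
by apply: leeB; [exact: ndG|exact: Ngt].
Unshelve. all: by end_near. Qed.

End measure.

(** * Young's inequality and the passage to product integrals *)

(** Young's inequality for v y^((m+3)/p) and 2D, with the coefficients 1/p and 1/q bounded by 1. The
    factor 2 on the left lets a single term v^p y^(m+3) absorb two such linear terms. *)
Lemma young_power (R : realType) (p q v y D : R) (m : nat) :
  1 < p -> 0 < q -> p^-1 + q^-1 = 1 -> 2 * q <= m.+3%:R ->
  0 <= v -> 0 <= y <= 1 -> 0 <= D ->
  2 * (v * (D * y ^+ m.+1)) <= v `^ p * y ^+ m.+3 + (2 * D) `^ q.
Proof.
move=> p1 q0 pq qm v0 /andP[y0 y1] D0; have p0 : 0 < p by exact: lt_trans p1.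
have [->|yn0] := eqVneq y 0.
  by rewrite !expr0n/= !mulr0 add0r powR_ge0.
have {y0} y0 : 0 < y by rewrite lt_def yn0.
(* Here (m+3)/p = (m+3) - (m+3)/q is at most m+1 because 2q <= m+3, and powers of [y <= 1] decrease
   in the exponent. *)
have ym : y ^+ m.+1 <= (y ^+ m.+3) `^ p^-1.
  rewrite -!powR_mulrn ?(ltW y0)// -powRrM; apply: ger_powR; first by rewrite y0.
  have -> : p^-1 = 1 - q^-1 by rewrite -pq addrK.
  have : 2 <= m.+3%:R * q^-1 by rewrite ler_pdivlMr.
  have -> : m.+3%:R = m.+1%:R + 2 :> R by rewrite -(natrD _ m.+1 2) addn2.
  by rewrite mulrBr mulr1; lra.
have := @conjugate_powR R (v * (y ^+ m.+3) `^ p^-1) (2 * D) p q.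
rewrite powRM ?powR_ge0// -powRrM mulVf ?gt_eqF// powRr1 ?exprn_ge0 ?(ltW y0)//.
have vy0 : 0 <= v * (y ^+ m.+3) `^ p^-1 by rewrite mulr_ge0 ?powR_ge0.
have D20 : 0 <= 2 * D by rewrite mulr_ge0.
move=> /(_ vy0 D20 p0 q0 pq) h; apply: (le_trans _ (le_trans h _)).
  have -> : 2 * (v * (D * y ^+ m.+1)) = v * y ^+ m.+1 * (2 * D) by ring.
  by rewrite ler_wpM2r// ler_wpM2l.
have q1 : q^-1 <= 1 by rewrite -pq lerDr invr_ge0 ltW.
have p1' : p^-1 <= 1 by rewrite -pq lerDl invr_ge0 ltW.
apply: lerD.
  rewrite -[leRHS]mulr1 ler_wpM2l// mulr_ge0 ?powR_ge0 ?exprn_ge0// ltW//.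
by rewrite -[leRHS]mulr1 ler_wpM2l// powR_ge0.
Qed.

Section half_line.
Context (R : realType) (n : nat).
Local Notation D := (@open_time_interval R +oo).
Local Notation mu := (@lebesgue_measure R).
Local Notation nu := (@lebesgue_rV R n).

Lemma open_time_interval_itv : D = `]0, +oo[%classic.
Proof.
apply/seteqP; split=> t /=; rewrite in_itv/= andbT; first by case.
by move=> t0; split=> //; exact: ltry.
Qed.

Lemma measurable_open_time_interval : measurable D.
Proof. by rewrite open_time_interval_itv; exact: measurable_itv. Qed.

(** This is Fubini's theorem, [H] being [F] extended by 0 to the times outside the half-line; it
    merges the iterated integrals of the weak formulation into integrals that can be added. *)
Lemma integral_half_line_prod (F : R -> 'rV[R]_n -> R)
    (H : measurableTypeR R * 'rV[R]_n -> R) :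
  (mu \x nu)%E.-integrable setT (EFin \o H) ->
  (forall t x, D t -> F t x = H (t, x)) ->
  (forall t x, ~ D t -> H (t, x) = 0) ->
  (\int[mu]_(t in D) \int[nu]_x (F t x)%:E = \int[mu \x nu]_z (H z)%:E)%E.
Proof.
move=> iH FH H0; rewrite -(integral12_prod_meas1 iH) integral_mkcond.
apply: eq_integral => t _; rewrite /patch /fubini_F/=; case: ifPn => [|].
  by rewrite inE => Dt; apply: eq_integral => x _; rewrite FH.
rewrite notin_setE => Dt; rewrite integral0_eq// => x _.
by rewrite H0.
Qed.

End half_line.

Lemma lebesgue_measure_segment (R : realType) (x y : R) : x <= y ->
  lebesgue_measure ([set` `[x, y]] : set R) = (y - x)%:E.
Proof.
rewrite lebesgue_measure_itv/= lte_fin le_eqVlt => /predU1P[->|->].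
  by rewrite ltxx subrr.
by rewrite -EFinB.
Qed.

Lemma measurable_vf_laplacian_cutoff (R : realType) (n k : nat) (r : R) :
  measurable_fun setT (vf_laplacian (@fields R n) (cutoff k.+3 r)).
Proof.
have mp (i j : 'I_n.+1) :
    measurable_fun setT (partial j (partial i (@cutoff R n.+1 k.+3 r))).
  rewrite partial2_cutoff; apply: measurable_funB.
    apply: measurable_funM; last exact: measurable_cutoff.
    apply: measurable_funM; apply: measurable_funM; try exact: measurable_cst.
      apply: measurable_funM; last exact: measurable_cst.
      exact: measurable_rV_coord.
    exact: measurable_rV_coord.
  by apply: measurable_funM; [exact: measurable_cst|exact: measurable_cutoff].
have mf (i : 'I_n.+1) :
    measurable_fun setT (fun x : 'rV[R]_n.+1 => field2 x ord0 i).
  case i0: (i == ord0); under eq_fun do rewrite mxE i0.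
    exact: measurable_cst.
  by apply: measurable_funX; exact: measurable_rV_coord.
rewrite (funext (fun x => vf_laplacian_fields x (@Ck_cutoff R n.+1 r k))).
apply: measurable_funD => //; apply: measurable_sum => j.
by apply: measurable_sum => i; do 2 apply: measurable_funM => //.
Qed.

(** * The estimate at a fixed radius *)

Section weak_solution_estimate.
Context (R : realType) (n k : nat) (p q : R).
Context (f u0 : 'rV[R]_n.+1 -> R) (u : R -> 'rV[R]_n.+1 -> R) (r : R).
Hypotheses (p1 : 1 < p) (q0 : 0 < q) (pq : p^-1 + q^-1 = 1).
Hypotheses (qk : 2 * q <= k.+3%:R) (r1 : 1 <= r).
Hypothesis weak_u : global_weak_solution (@fields R n) p f u0 u.

Local Notation D := (@open_time_interval R +oo).
Local Notation mu := (@lebesgue_measure R).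
Local Notation nu := (@lebesgue_rV R n.+1).
Let r0 : 0 < r. Proof. exact: lt_le_trans r1. Qed.
(** Parabolic scaling: a time derivative then costs r^(-2), as Delta_X does. *)
Let T : R := r ^+ 2.
Let T0 : 0 < T. Proof. exact: exprn_gt0. Qed.
Let J : set (measurableTypeR R) := `[T, 3 * T]%classic.
Let K := @box R n.+1 r.
Let S := J `*` K.
Let a (t : measurableTypeR R) : R := time_cutoff k.+3 T t.
Let a' (t : measurableTypeR R) : R := time_cutoff' k.+2 T t.
Let b (x : 'rV[R]_n.+1) : R := cutoff k.+3 r x.
Let L (x : 'rV[R]_n.+1) : R := vf_laplacian (@fields R n) b x.
Let C : R := 6 * k.+3%:R ^+ 2 * (1 + n.+1%:R ^+ 2).
(** The time and space cutoffs of exponent [m] multiply to [y ^+ m], so all powers are compared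
    through one number in [0, 1]. *)
Let y (z : measurableTypeR R * 'rV[R]_n.+1) : R :=
  time_cutoff 1 T z.1 * cutoff 1 r z.2.
(** Extension by 0 gives a measurable function on the whole product space, whatever [u] is at
    nonpositive times. *)
Let v : measurableTypeR R * 'rV[R]_n.+1 -> R :=
  (fun z => u z.1 z.2) \_ (D `*` setT).
Let A z : R := `|v z| `^ p * (a z.1 * b z.2).
Let B z : R := v z * (a' z.1 * b z.2).
Let E z : R := v z * (a z.1 * L z.2).
Let M : R := (2 * (C * r ^- 2)) `^ q.

Let mJ : measurable J. Proof. exact: measurable_itv. Qed.
Let mK : measurable K. Proof. exact: measurable_box. Qed.
Let mS : measurable S. Proof. exact: measurableX. Qed.

Let measurable_snd_comp (g : 'rV[R]_n.+1 -> R) :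
  measurable_fun setT g ->
  measurable_fun setT (fun z : measurableTypeR R * 'rV[R]_n.+1 => g z.2).
Proof. by move=> mg; exact: (measurableT_comp mg measurable_snd). Qed.

Let measurable_fst_comp (g : R -> R) :
  continuous g ->
  measurable_fun setT (fun z : measurableTypeR R * 'rV[R]_n.+1 => g z.1).
Proof.
move=> cg; apply: (measurableT_comp (f := g : measurableTypeR R -> R)).
  exact: continuous_measurable_fun.
exact: measurable_fst.
Qed.

Let mv : measurable_fun setT v.
Proof.
have mD : measurable (D `*` [set: 'rV[R]_n.+1]).
  by apply: measurableX => //; exact: measurable_open_time_interval.
by apply/(measurable_restrictT _ mD); exact: weak_u.1.1.
Qed.

Let mvp : measurable_fun setT (fun z => `|v z| `^ p).
Proof.
apply: (measurableT_comp (measurable_powR p)).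
exact: measurableT_comp.
Qed.

Let mA : measurable_fun setT A.
Proof.
apply: measurable_funM => //; apply: measurable_funM.
  by apply: measurable_fst_comp; exact: continuous_time_cutoff.
by apply: measurable_snd_comp; exact: measurable_cutoff.
Qed.

Let mB : measurable_fun setT B.
Proof.
apply: measurable_funM => //; apply: measurable_funM.
  by apply: measurable_fst_comp; exact: continuous_time_cutoff'.
by apply: measurable_snd_comp; exact: measurable_cutoff.
Qed.

Let mE : measurable_fun setT E.
Proof.
apply: measurable_funM => //; apply: measurable_funM.
  by apply: measurable_fst_comp; exact: continuous_time_cutoff.
by apply: measurable_snd_comp; exact: measurable_vf_laplacian_cutoff.
Qed.

Let y01 z : 0 <= y z <= 1.
Proof.
rewrite mulr_ge0 ?time_cutoff_ge0 ?cutoff_ge0//=.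
by rewrite mulr_ile1 ?time_cutoff_ge0 ?cutoff_ge0 ?time_cutoff_le1 ?cutoff_le1.
Qed.

Let y_pow z (m : nat) : time_cutoff m T z.1 * cutoff m r z.2 = y z ^+ m.
Proof. by rewrite /y exprMn /time_cutoff /cutoff /pospow !expr1. Qed.

Let y_out z : ~ S z -> y z = 0.
Proof.
move=> Sz; apply/eqP/negPn/negP; rewrite mulf_eq0 negb_or => /andP[yt yx].
apply: Sz; split; last exact: cutoff_neq0_box yx.
move: (time_cutoff_neq0 T0 yt); rewrite /J/= in_itv/= ler_norml.
by move=> /andP[? ?]; apply/andP; split; lra.
Qed.

Let kC : 0 <= C /\ 2 * k.+3%:R <= C.
Proof.
have k1 : 1 <= k.+3%:R :> R by rewrite ler1n.
have n0 : 0 <= n.+1%:R ^+ 2 :> R by exact: sqr_ge0.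
have C6 : 6 * k.+3%:R ^+ 2 <= C.
  by rewrite /C ler_peMr ?lerDl ?mulr_ge0 ?sqr_ge0.
by split; apply: le_trans C6; nra.
Qed.

(** On [S] this is [young_power] with [C * r ^- 2] for [D]; off [S], [y z = 0] forces [w = 0]. *)
Let young z (w : R) : `|w| <= C * r ^- 2 * y z ^+ k.+1 ->
  2 * `|v z * w| <= A z + M * \1_S z.
Proof.
move=> wy; have [C0 _] := kC.
have Cr0 : 0 <= C * r ^- 2 by rewrite mulr_ge0// invr_ge0 sqr_ge0.
rewrite /A /a /b y_pow indicE; case: (boolP (z \in S)) => [_|].
  rewrite mulr1; apply: le_trans (young_power p1 q0 pq qk _ (y01 z) Cr0) => //.
  by rewrite normrM ler_wpM2l// ler_wpM2l.
rewrite notin_setE => /y_out yz; move: wy.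
by rewrite yz !expr0n/= !mulr0 addr0 normr_le0 => /eqP ->; rewrite mulr0 normr0 mulr0.
Qed.

(** The time derivative leaves the exponent [k.+2] and a factor 1 / T = r^(-2). Both cutoffs are
    then lowered to the exponent [k.+1], which only increases them. *)
Let B_young z : 2 * `|B z| <= A z + M * \1_S z.
Proof.
apply: young; have [C0 kC'] := kC; have /andP[y0 _] := y01 z.
have k2 : cutoff k.+3 r z.2 <= cutoff k.+1 r z.2 by apply: ler_cutoff; lia.
rewrite normrM (ger0_norm (cutoff_ge0 _ _ _)) -y_pow mulrA.
apply: ler_pM; rewrite ?cutoff_ge0//.
rewrite (le_trans (time_cutoff'_le T0 _ _))//.
apply: ler_pM; rewrite ?time_cutoff_ge0 ?ler_time_cutoff//.
  by rewrite divr_ge0 ?mulr_ge0// ltW.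
by rewrite ler_wpM2r// invr_ge0 ltW.
Qed.

Let E_young z : 2 * `|E z| <= A z + M * \1_S z.
Proof.
apply: young; rewrite normrM (ger0_norm (time_cutoff_ge0 _ _ _)) -y_pow.
rewrite mulrCA; apply: ler_pM => //.
- exact: time_cutoff_ge0.
- by apply: ler_time_cutoff; lia.
- exact: vf_laplacian_cutoff_le.
Qed.

Let A_ge0 z : 0 <= A z.
Proof.
apply: mulr_ge0; first exact: powR_ge0.
by apply: mulr_ge0; [exact: time_cutoff_ge0|exact: cutoff_ge0].
Qed.

Let lebesgue_S : ((mu \x nu) S <=
  (2 * T * (2 ^+ n.+1 * r ^+ (2 ^ n.+1).-1))%:E)%E.
Proof.
have lJ : (lebesgue_measure ([set` `[T, 3 * T]%R] : set R) <= (2 * T)%:E)%E.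
  have := T0; move: (T) => s s0.
  by rewrite lebesgue_measure_segment ?lee_fin; lra.
rewrite product_measure1E// EFinM; apply: lee_pmul => //.
exact: lebesgue_rV_box_le.
Qed.

Let integrable_S : (mu \x nu)%E.-integrable setT (fun z => (M * \1_S z)%:E).
Proof.
under eq_fun do rewrite EFinM.
apply: integrableZl => //; apply/integrableP; split.
  exact/measurable_EFinP/measurable_indic.
under eq_integral do rewrite abse_EFin ger0_norm//.
by rewrite integral_indic// setIT (le_lt_trans lebesgue_S)// ltry.
Qed.

Let integral_S : (\int[mu \x nu]_z (M * \1_S z)%:E <=
  (M * (2 * T * (2 ^+ n.+1 * r ^+ (2 ^ n.+1).-1)))%:E)%E.
Proof.
under eq_integral do rewrite EFinM.
have mi : measurable_fun setT (fun z : measurableTypeR R * 'rV[R]_n.+1 =>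
    (\1_S z : R)%:E) by exact/measurable_EFinP/measurable_indic.
have M0 : (0 <= M%:E)%E by rewrite lee_fin powR_ge0.
rewrite ge0_integralZl//.
by rewrite integral_indic// setIT EFinM lee_wpmul2l.
Qed.

Let JD t : J t -> D t.
Proof.
rewrite /J/= in_itv/= => /andP[tT _]; split; last exact: ltry.
exact: lt_le_trans tT.
Qed.

(** [A] is dominated by [|v|^p] on [S]. Local p-integrability applies there because the time
    interval starts at [T > 0], away from the initial time. *)
Let integrable_A : (mu \x nu)%E.-integrable setT (EFin \o A).
Proof.
have mW : measurable_fun setT (fun z => (`|v z| `^ p * \1_S z)%:E).
  apply/measurable_EFinP/measurable_funM => //; exact: measurable_indic.
apply: (@le_integrable _ _ _ _ _ measurableT _
    (fun z => (`|v z| `^ p * \1_S z)%:E)); first exact/measurable_EFinP.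
  move=> z _; rewrite /= lee_fin (ger0_norm (A_ge0 z)).
  rewrite (ger0_norm (mulr_ge0 (powR_ge0 _ _) (_ : 0 <= \1_S z)))//.
  rewrite /A /a /b ler_wpM2l ?powR_ge0// y_pow indicE.
  have /andP[y0 y1] := y01 z; case: (boolP (z \in S)) => [_|].
    by rewrite exprn_ile1.
  by rewrite notin_setE => /y_out ->; rewrite expr0n.
apply/integrable12ltyP => //.
have [_ /(_ T (3 * T) K T0 (ltry _) (@compact_box R n.+1 r))] := weak_u.1.
congr (_ < _)%E; rewrite integral_mkcond; apply: eq_integral => t _.
rewrite /patch; case: ifPn => [|].
  rewrite inE => Jt; rewrite integral_mkcond; apply: eq_integral => x _.
  rewrite /= (ger0_norm (mulr_ge0 (powR_ge0 _ _) (_ : 0 <= \1_S (t, x))))//.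
  rewrite /patch indicE.
  have -> : v (t, x) = u t x.
    by rewrite /v /patch mem_set//; split=> //=; exact: JD.
  case: ifPn; first by rewrite inE => Kx; rewrite mem_set ?mulr1.
  rewrite notin_setE => Kx; rewrite memNset ?mulr0//.
  by move=> [].
rewrite notin_setE => Jt; rewrite integral0_eq// => x _.
by rewrite indicE memNset ?mulr0 ?abse0// => -[].
Qed.

(** Young's bound also yields integrability of the terms linear in [u], from that of [A] and the
    finite measure of [S]. *)
Let integrable_young (F : measurableTypeR R * 'rV[R]_n.+1 -> R) :
  measurable_fun setT F -> (forall z, 2 * `|F z| <= A z + M * \1_S z) ->
  (mu \x nu)%E.-integrable setT (EFin \o F).
Proof.
move=> mF FA; apply: (le_integrable measurableT _ _
  (integrableD measurableT integrable_A integrable_S)).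
  exact/measurable_EFinP.
move=> z _; rewrite /= lee_fin (le_trans _ (ler_norm _))//.
by apply: le_trans (FA z); rewrite ler_peMl//; lra.
Qed.

(** The inner integral is [a t] times the mass of [f * b]. It is kept only on the middle half of the
    time support, of length [T], where [a] is at least [(3 / 4) ^+ k.+3]. *)
Let integral_time_cutoff_ge (e : R) : 0 <= e ->
  (e%:E <= \int[nu]_x (f x * b x)%:E)%E ->
  (nu.-integrable setT (fun x => (f x * b x)%:E)) ->
  ((e * ((3 / 4) ^+ k.+3 * T))%:E <=
   \int[mu]_(t in D) \int[nu]_x (f x * (a t * b x))%:E)%E.
Proof.
move=> e0 ef ifb; set I := (\int[nu]_x _)%E in ef.
have Ifin : I \is a fin_num by exact: integrable_fin_num.
have E1 t : (\int[nu]_x (f x * (a t * b x))%:E = (a t * fine I)%:E)%E.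
  rewrite EFinM fineK// -integralZl//; apply: eq_integral => x _.
  by rewrite -EFinM mulrCA.
have I0 : e <= fine I by rewrite -lee_fin fineK.
have ma : measurable_fun setT (fun t : measurableTypeR R => (a t * fine I)%:E).
  apply/measurable_EFinP/measurable_funM; last exact: measurable_cst.
  by apply: continuous_measurable_fun; exact: continuous_time_cutoff.
under eq_integral do rewrite E1.
pose J1 : set (measurableTypeR R) := [set` `[3 / 2 * T, 5 / 2 * T]].
have mJ1 : measurable J1 by exact: measurable_itv.
have JD1 : J1 `<=` D.
  move=> t; rewrite /J1/= in_itv/= => /andP[tT _]; split; last exact: ltry.
  by apply: lt_le_trans tT; rewrite mulr_gt0// T0.
have lJ1 : mu J1 = T%:E.
  rewrite [LHS](_ : _ = lebesgue_measure ([set` `[3 / 2 * T, 5 / 2 * T]%R] : set R))//.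
  have := T0; move: (T) => s s0.
  by rewrite lebesgue_measure_segment; [congr EFin; lra|lra].
have aI0 t : (0 <= (a t * fine I)%:E)%E.
  by rewrite lee_fin mulr_ge0 ?time_cutoff_ge0// (le_trans e0).
apply: (@le_trans _ _ (\int[mu]_(t in J1) (a t * fine I)%:E)%E); last first.
  apply: ge0_subset_integral => //; first exact: measurable_open_time_interval.
  exact: measurable_funTS.
rewrite mulrA EFinM -lJ1 -integral_cst//; apply: ge0_le_integral => //.
- by move=> t _; rewrite lee_fin mulr_ge0// exprn_ge0.
- exact: measurable_funTS.
- move=> t; rewrite /J1/= in_itv/= => tJ; rewrite lee_fin mulrC.
  by apply: ler_pM => //; exact: time_cutoff_lower.
Qed.

Lemma weak_solution_mass_le (e : R) : L1loc f -> 0 <= e ->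
  (e%:E <= \int[nu]_x (f x * cutoff k.+3 r x)%:E)%E ->
  e * (3 / 4) ^+ k.+3 <=
  (2 * (C * r ^- 2)) `^ q * 2 * (2 ^+ n.+1 * r ^+ (2 ^ n.+1).-1).
Proof.
move=> Lf e0 ef; have iF := integrable_mul_cutoff k.+2 Lf r0.
have iB := integrable_young mB B_young; have iE := integrable_young mE E_young.
have vD t x : D t -> v (t, x) = u t x.
  by move=> Dt; rewrite /v /patch mem_set//; split.
have vN t x : ~ D t -> v (t, x) = 0.
  by move=> Dt; rewrite /v /patch memNset// => -[].
have := weak_u.2 _ _ (test_function_cutoff n.+1 k r1 T0).
have psi0 t x : time_interval +oo t -> 0 <= a t * b x.
  by move=> _; rewrite mulr_ge0 ?time_cutoff_ge0 ?cutoff_ge0.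
move=> /(_ psi0).
rewrite (@integral_half_line_prod _ _ (fun t x => `|u t x| `^ p * (a t * b x)) A)//; last 2 first.
- by move=> t x Dt; rewrite /A vD.
- by move=> t x Dt; rewrite /A vN// normr0 powR0 ?mul0r// gt_eqF// (lt_trans ltr01).
(* The initial term vanishes: at t = 0 the time profile is 1 - 4 < 0. *)
rewrite [X in (_ + X + _ + _ + _)%E]integral0_eq => [|x _]; last first.
  rewrite (_ : time_cutoff k.+3 T 0 = 0) ?mul0r ?mulr0//.
  apply: pospow0; rewrite sub0r mulNr mulfK ?gt_eqF ?T0// sqrrN subr_le0.
  by rewrite -natrX ler1n.
rewrite (@integral_half_line_prod _ _ (fun t x => u t x * (a' t * b x)) B)//; last 2 first.
- by move=> t x Dt; rewrite /B vD.
- by move=> t x Dt; rewrite /B vN// mul0r.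
rewrite (@integral_half_line_prod _ _ (fun t x =>
  u t x * vf_laplacian (@fields R n) (fun x => a t * b x) x) E)//; last 2 first.
- move=> t x Dt; rewrite /E vD//; congr (_ * _).
  exact/vf_laplacian_scale/Ck_cutoff.
- by move=> t x Dt; rewrite /E vN// mul0r.
rewrite adde0 => sum0.
(* Adding the two Young bounds gives [|B| + |E| <= A + M * \1_S] pointwise, so the whole of [A]
   absorbs both linear terms. *)
have ABE : (0 <= \int[mu \x nu]_z (A z)%:E + \int[mu \x nu]_z (B z)%:E
    + \int[mu \x nu]_z (E z)%:E + \int[mu \x nu]_z (M * \1_S z)%:E)%E.
  have iM := integrable_S.
  have iAB := integrableD measurableT integrable_A iB.
  have iABE := integrableD measurableT iAB iE.
  rewrite -(integralD measurableT integrable_A iB).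
  rewrite -(integralD measurableT iAB iE) -(integralD measurableT iABE iM).
  apply: integral_ge0 => z _; rewrite /= lee_fin.
  have := B_young z; have := E_young z.
  have := ler_norm (- B z); have := ler_norm (- E z); rewrite !normrN; lra.
have Ffin : (\int[mu]_(t in D) \int[nu]_x (f x * (a t * b x))%:E <=
    \int[mu \x nu]_z (M * \1_S z)%:E)%E.
  move: sum0 ABE.
  have [/fineK <- /fineK <- /fineK <-] : [/\ \int[mu \x nu]_z (A z)%:E \is a fin_num,
      \int[mu \x nu]_z (B z)%:E \is a fin_num &
      \int[mu \x nu]_z (E z)%:E \is a fin_num]%E.
    by split; apply: integrable_fin_num.
  have /fineK <- : (\int[mu \x nu]_z (M * \1_S z)%:E)%E \is a fin_num.
    by apply: integrable_fin_num => //; exact: integrable_S.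
  (* The other three terms are finite, so an infinite value would contradict the identity. *)
  case: (\int[mu]_(t in D) _)%E => // s; rewrite -!EFinD => -[s0].
  by rewrite !lee_fin; lra.
have := le_trans (integral_time_cutoff_ge e0 ef iF) (le_trans Ffin integral_S).
(* Both time intervals have length proportional to [T], which cancels. *)
rewrite lee_fin; have -> : e * ((3 / 4) ^+ k.+3 * T) = T * (e * (3 / 4) ^+ k.+3) by ring.
rewrite (_ : M * _ = T * (M * 2 * (2 ^+ n.+1 * r ^+ (2 ^ n.+1).-1))); last by ring.
by rewrite ler_pM2l.
Qed.

End weak_solution_estimate.

(* The dimension is n.+1. *)
Theorem theorem4p1 (R : realType) (n : nat) (hn : (2 < n.+1)%N)
  (p : R) (hp1 : 1 < p) (hp2 : p < (2 ^+ n.+1 - 1) / (2 ^+ n.+1 - 3))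
  (u0 : 'rV[R]_n.+1 -> R) (hu0 : L1loc u0)
  (f : 'rV[R]_n.+1 -> R) (hf : L1loc f)
  (hfpos : (0 < \int[lebesgue_rV n.+1]_x (f x)%:E)%E) :
  ~ exists u : R -> 'rV[R]_n.+1 -> R,
      global_weak_solution (@fields R n) p f u0 u.
Proof.
move=> [u weak_u]; set P := (2 ^ n.+1).-1.
have p0 : 0 < p by exact: lt_trans hp1.
have p10 : 0 < p - 1 by rewrite subr_gt0.
pose q := p / (p - 1).
have q0 : 0 < q by rewrite divr_gt0.
have pq : p^-1 + q^-1 = 1 by rewrite /q; field; rewrite !gt_eqF.
(* This is the hypothesis on [p] rewritten for its conjugate exponent; the dimension being at least
   3 makes the denominator 2^(n+1) - 3 positive. *)
have Pq : P%:R < 2 * q.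
  have PE : P%:R = 2 ^+ n.+1 - 1 :> R.
    by rewrite /P -subn1 natrB ?expn_gt0// natrX.
  have M8 : 8 <= 2 ^+ n.+1 :> R.
    by rewrite -natrX ler_nat (@leq_exp2l 2 3).
  have M3 : 0 < 2 ^+ n.+1 - 3 :> R by lra.
  move: hp2; rewrite (ltr_pdivlMr _ _ M3) PE /q mulrA ltr_pdivlMr//.
  by move: (2 ^+ n.+1) => M; lra.
(* The cutoff exponent [k.+3] is taken large enough for [young_power]. *)
have [k qk] : exists k : nat, 2 * q <= k.+3%:R.
  exists (Num.bound (2 * q)).
  have /ltW := archi_boundP (mulr_ge0 (ler0n R 2) (ltW q0)).
  by move=> /le_trans; apply; rewrite ler_nat -addn3 leq_addr.
have [e e0 [j0 ej]] := mass_cutoff_ge k.+2 hf hfpos.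
pose C : R := 6 * k.+3%:R ^+ 2 * (1 + n.+1%:R ^+ 2).
have C0 : 0 <= C.
  apply: mulr_ge0; first by apply: mulr_ge0 => //; exact: sqr_ge0.
  by apply: addr_ge0 => //; exact: sqr_ge0.
pose c : R := e * (3 / 4) ^+ k.+3.
have c0 : 0 < c by rewrite mulr_gt0// exprn_gt0.
pose K : R := (2 * C) `^ q * 2 * 2 ^+ n.+1.
have K0 : 0 <= K.
  by apply: mulr_ge0; [apply: mulr_ge0 => //; exact: powR_ge0|exact: exprn_ge0].
pose d := 2 * q - P%:R.
have d0 : 0 < d by rewrite subr_gt0.
(* The estimate at radius r reads c <= K r^(-2q) r^P = K r^(-d), with c and K independent of r. *)
have bound (j : nat) : (j0 <= j)%N -> c * j.+1%:R `^ d <= K.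
  move=> /ej; have r1 : 1 <= j.+1%:R :> R by rewrite ler1n.
  set r : R := j.+1%:R in r1 *; have r0 : 0 < r by exact: lt_le_trans r1.
  move=> /(weak_solution_mass_le hp1 q0 pq qk r1 weak_u hf (ltW e0)).
  rewrite -/c -/C -/P => h.
  have rd : r `^ (2 * q) = r `^ d * r ^+ P.
    rewrite -{1}(subrK P%:R (2 * q)) -/d powRD ?(gt_eqF r0) ?implybT//.
    by rewrite powR_mulrn ?(ltW r0).
  have rq : (r ^- 2) `^ q * r `^ (2 * q) = 1.
    rewrite powRrM powR_mulrn ?(ltW r0)// -powRM ?invr_ge0 ?sqr_ge0//.
    by rewrite mulVf ?powR1// gt_eqF// exprn_gt0.
  have rP : 0 < r ^+ P by rewrite exprn_gt0.
  rewrite -(ler_pM2r rP) -mulrA -rd.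
  suff -> : K * r ^+ P =
      (2 * (C * r ^- 2)) `^ q * 2 * (2 ^+ n.+1 * r ^+ P) * r `^ (2 * q).
    by rewrite ler_wpM2r ?powR_ge0.
  have -> : (2 * (C * r ^- 2)) `^ q = (2 * C) `^ q * (r ^- 2) `^ q.
    by rewrite mulrA powRM ?invr_ge0 ?sqr_ge0 ?mulr_ge0.
  transitivity (K * r ^+ P * ((r ^- 2) `^ q * r `^ (2 * q))).
    by rewrite rq mulr1.
  by rewrite /K; ring.
(* Chosen so that [c * X = K + c > K]; a radius whose power [d] is at least [X] then violates the
   bound. *)
pose X := K / c + 1.
have X0 : 0 < X by rewrite ltr_wpDl// divr_ge0// ltW.
pose j := maxn j0 (Num.bound (X `^ d^-1)).
have := bound j (leq_maxl _ _).
apply/negP; rewrite -ltNge; apply: (@lt_le_trans _ _ (c * X)).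
  by rewrite /X mulrDr mulr1 mulrCA divff ?gt_eqF// mulr1 ltrDl.
rewrite ler_wpM2l ?(ltW c0)//.
have -> : X = (X `^ d^-1) `^ d by rewrite -powRrM mulVf ?gt_eqF// powRr1 ?ltW.
rewrite ge0_ler_powR ?nnegrE ?powR_ge0 ?(ltW d0)//.
have /ltW := archi_boundP (powR_ge0 X d^-1).
by move=> /le_trans; apply; rewrite ler_nat leqW// leq_maxr.
Qed.
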